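(* Let $\mathfrak S$ be a symmetrically-normed ideal, let $f:[0,\infty)\to\mathbb R$ be an operator monotone function with integral representation $$f(\lambda)=\alpha+\beta\lambda-\int_0^\infty\Big(\frac1{t+\lambda}-\frac{t}{t^2+1}\Big)\,d\nu(t),\qquad\lambda\in[0,\infty),$$ where $\alpha\in\mathbb R$, $\beta\ge0$ and $\nu$ is a positive Borel measure on $(0,\infty)$ with $\int_0^\infty(t^2+1)^{-1}d\nu(t)<\infty$, and let $C\in\mathcal{G}\ell^+$. Consider $f:(C+\mathfrak S)\cap\mathcal{G}\ell^+\to f(C)+\mathfrak S_{sa}$ given by $D\mapsto f(D)$. Then $f$ is a real analytic function. Moreover, for $D\in(C+\mathfrak S)\cap\mathcal{G}\ell^+$ with $\|D-C\|_{\mathfrak S}<\gamma_C$ we get a local series representation $f(D)=f(C)+\sum_{n=1}^\infty f_n(D-C)$, where $$f_1(D-C)=\beta(D-C)+\int_0^\infty(tI+C)^{-1}(D-C)(tI+C)^{-1}\,d\nu(t)\in\mathfrak S_{sa},$$ $$f_n(D-C)=(-1)^{n+1}\int_0^\infty\big((tI+C)^{-1}(D-C)\big)^n(tI+C)^{-1}\,d\nu(t)\in\mathfrak S_{sa},\qquad n\ge2.$$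
   Context: $\mathcal H$ is a separable complex infinite-dimensional Hilbert space, $\mathcal B(\mathcal H)$ its bounded operators with operator norm $\|\cdot\|$. A function $f:[0,\infty)\to\mathbb R$ is operator monotone if $0\le C\le D$ in $\mathcal B(\mathcal H)$ implies $f(C)\le f(D)$; $f(C)$ is defined by functional calculus. $\mathcal{G}\ell^+$ is the set of positive invertible operators on $\mathcal H$. For $C\in\mathcal{G}\ell^+$, $\gamma_C=\min\sigma(C)=\|C^{-1}\|^{-1}$. A symmetrically-normed ideal is a two-sided ideal $\mathfrak S\subseteq\mathcal B(\mathcal H)$ with a norm $\|\cdot\|_{\mathfrak S}$ making it a Banach space, such that $\|XBY\|_{\mathfrak S}\le\|X\|\,\|B\|_{\mathfrak S}\|Y\|$ for $X,Y\in\mathcal B(\mathcal H)$, $B\in\mathfrak S$, and $\|B\|_{\mathfrak S}=\|B\|$ for every rank-one $B$. One has (finite-rank operators) $\subseteq\mathfrak S\subseteq$ (compact operators). $\mathfrak S_{sa}$ denotes the self-adjoint operators in $\mathfrak S$. The set $(C+\mathfrak S)\cap\mathcal{G}\ell^+=\{D\in\mathcal{G}\ell^+:D-C\in\mathfrak S\}$ is regarded as an open subset of the real affine Banach space $C+\mathfrak S_{sa}$, with metric $\|D_1-D_2\|_{\mathfrak S}$; $f(C)+\mathfrak S_{sa}$ carries the analogous structure. A map between such spaces is real analytic if near each point it is the sum of a convergent power series of continuous homogeneous polynomials. The operator-valued integrals are understood weakly: $\langle\int h\,d\nu\,x,y\rangle=\int\langle h(t)x,y\rangle\,d\nu(t)$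 for $x,y\in\mathcal H$. *)

(* Defs.v *)
From HB Require Import structures.
From mathcomp Require Import all_boot all_order all_algebra.
From mathcomp Require Import sesquilinear complex.
From mathcomp Require Import all_classical all_reals all_analysis.

Set Implicit Arguments.
Unset Strict Implicit.
Unset Printing Implicit Defensive.

Import Order.TTheory GRing.Theory Num.Theory.
Import numFieldNormedType.Exports.

Local Open Scope classical_set_scope.
Local Open Scope ring_scope.
Local Open Scope complex_scope.

(** A complex Hilbert space is a complete normed module [H] over [R[i]] with an
    inner product [ip : {dot H for Num.conj}] (linear in its first argument)
    that induces the norm.  Norms of vectors are elements of [R[i]]; [vnorm] is
    the corresponding element of [R]. *)

Definition induces_norm (R : realType) (H : completeNormedModType R[i])
    (ip : {dot H for (@Num.conj R[i])}) : Prop :=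
  forall x : H, `|x| ^+ 2 = ip x x.

Definition separable (T : topologicalType) : Prop :=
  exists2 Q : set T, countable Q & dense Q.

Definition infinite_dimensional (K : fieldType) (V : lmodType K) : Prop :=
  forall (n : nat) (e : 'I_n -> V),
    exists v, forall c : 'I_n -> K, v <> \sum_(i < n) c i *: e i.

(** Operators are plain functions [H -> H], added and scaled pointwise;
    [bounded_op] singles out B(H). *)

Section Operators.
Context {R : realType} {H : completeNormedModType R[i]}.
Implicit Types (A B C T X Y : H -> H) (x y : H).

Definition vnorm x : R := complex.Re `|x|.

Definition bounded_op A : Prop :=
  linear A /\ exists M : R, forall x, vnorm (A x) <= M * vnorm x.

Definition opnorm A : R := sup [set vnorm (A x) | x in [set x | vnorm x <= 1]].

Definition rank_one A : Prop :=
  bounded_op A /\ exists2 u : H, u != 0 & range A = [set c *: u | c in setT].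

Definition is_op_inverse A B : Prop :=
  [/\ bounded_op B, A \o B = idfun & B \o A = idfun].

Definition op_invertible A : Prop := exists B, is_op_inverse A B.

Definition opinv A : H -> H := xget 0 [set B | is_op_inverse A B].

Definition spectrum A : set R[i] :=
  [set l | ~ op_invertible (A - l *: idfun)].

Definition real_spectrum A : set R := [set l | spectrum A l%:C].

(** The spectrum of a positive operator is a non-empty compact subset of the
    real half-line, so this infimum is attained: it is the minimum. *)
Definition spectral_min A : R := inf (real_spectrum A).

Definition polyop (p : {poly R}) A : H -> H :=
  \sum_(i < size p) (p`_i)%:C *: iter i A.

(** [T] is f(A), for [A] self-adjoint and [f] continuous on the spectrum of [A]
    (the values of [f] elsewhere are irrelevant). *)
Definition is_fcalc (f : R -> R) A T : Prop :=
  bounded_op T /\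
  exists p : nat -> {poly R},
    (forall e : R, 0 < e -> \forall n \near \oo,
       forall l : R, real_spectrum A l -> `|(p n).[l] - f l| < e) /\
    opnorm (polyop (p n) A - T) @[n --> \oo] --> (0 : R).

Definition fcalc (f : R -> R) A : H -> H := xget 0 [set T | is_fcalc f A T].

Variable ip : {dot H for (@Num.conj R[i])}.

Definition selfadjoint A : Prop := forall x y, ip (A x) y = ip x (A y).

(** [0 <= z] in [R[i]] means that [z] is a nonnegative real, so a positive
    operator is self-adjoint. *)
Definition positive_op A : Prop := bounded_op A /\ forall x, 0 <= ip (A x) x.

Definition le_op A B : Prop := positive_op (B - A).

Definition positive_invertible A : Prop := positive_op A /\ op_invertible A.

(** For functions on the half-line, represented by functions [R -> R] whose
    values at negative numbers are never used.  The calculus above covers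
    functions that are continuous on the spectra involved. *)
Definition operator_monotone (f : R -> R) : Prop :=
  forall C D, positive_op C -> positive_op D -> le_op C D ->
    le_op (fcalc f C) (fcalc f D).

Definition is_weak_integral (nu : {measure set R -> \bar R}) (E : set R)
    (h : R -> H -> H) T : Prop :=
  bounded_op T /\
  forall x y,
    [/\ nu.-integrable E (fun t => (complex.Re (ip (h t x) y))%:E),
        nu.-integrable E (fun t => (complex.Im (ip (h t x) y))%:E)
      & ip (T x) y = (\int[nu]_(t in E) complex.Re (ip (h t x) y)) +i*
                     (\int[nu]_(t in E) complex.Im (ip (h t x) y))].

Definition weakly_integrable nu E h : Prop :=
  exists T, is_weak_integral nu E h T.

Definition weak_integral nu E h : H -> H :=
  xget 0 [set T | is_weak_integral nu E h T].

End Operators.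

(** [snorm] is only meaningful on the ideal.  Stability under scalars is
    [ideal_mul] with a multiple of the identity. *)
Record symNormedIdeal (R : realType) (H : completeNormedModType R[i]) :=
  SymNormedIdeal {
    ideal_set : set (H -> H);
    snorm : (H -> H) -> R;
    ideal_bounded : forall A, ideal_set A -> bounded_op A;
    ideal0 : ideal_set 0;
    ideal_add : forall A B, ideal_set A -> ideal_set B -> ideal_set (A + B);
    ideal_mul : forall X B Y, bounded_op X -> ideal_set B -> bounded_op Y ->
      ideal_set (X \o B \o Y);
    snorm_eq0 : forall A, ideal_set A -> snorm A = 0 -> A = 0;
    snormZ : forall (c : R[i]) A, ideal_set A ->
      snorm (c *: A) = complex.Re `|c| * snorm A;
    snorm_triangle : forall A B, ideal_set A -> ideal_set B ->
      snorm (A + B) <= snorm A + snorm B;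
    snorm_complete : forall A : nat -> H -> H,
      (forall n, ideal_set (A n)) ->
      (forall e : R, 0 < e -> exists N, forall m n, (N <= m)%N -> (N <= n)%N ->
         snorm (A m - A n) < e) ->
      exists2 B, ideal_set B & snorm (A n - B) @[n --> \oo] --> (0 : R);
    snorm_mul : forall X B Y, bounded_op X -> ideal_set B -> bounded_op Y ->
      snorm (X \o B \o Y) <= opnorm X * snorm B * opnorm Y;
    snorm_rank_one : forall B, rank_one B ->
      ideal_set B /\ snorm B = opnorm B }.

Section Analytic.
Context {R : realType} {H : completeNormedModType R[i]}.
Variables (ip : {dot H for (@Num.conj R[i])}) (S : symNormedIdeal H).

Definition ideal_sa : set (H -> H) := [set A | ideal_set S A /\ selfadjoint ip A].

(** S_sa is a real Banach space only, hence the real scalars [a%:C];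
    boundedness of a multilinear map is its continuity. *)
Definition bounded_multilinear (n : nat) (M : ('I_n -> H -> H) -> H -> H) :
    Prop :=
  [/\ forall X : 'I_n -> H -> H, (forall i, ideal_sa (X i)) -> ideal_sa (M X),
      forall (X : 'I_n -> H -> H) (i : 'I_n) (a : R) (Y Z : H -> H),
        (forall j, ideal_sa (X j)) -> ideal_sa Y -> ideal_sa Z ->
        M [eta X with i |-> a%:C *: Y + Z] =
        a%:C *: M [eta X with i |-> Y] + M [eta X with i |-> Z]
    & exists K : R, forall X : 'I_n -> H -> H, (forall i, ideal_sa (X i)) ->
        snorm S (M X) <= K * \prod_(i < n) snorm S (X i)].

Definition homogeneous_polynomial (n : nat) (P : (H -> H) -> H -> H) : Prop :=
  exists2 M : ('I_n -> H -> H) -> H -> H, bounded_multilinear M &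
    forall X, ideal_sa X -> P X = M (fun=> X).

(** [F], defined on a subset [U] of C + S_sa with values in some B + S_sa, is
    analytic at [D] when a ball around [D] is contained in [U] and on this ball
    F(D + X) is the sum, in the norm of S, of a power series with constant term
    F(D) that converges normally. *)
Definition analytic_at (U : set (H -> H)) (F : (H -> H) -> H -> H)
    (D : H -> H) : Prop :=
  exists (r : R) (P : nat -> (H -> H) -> H -> H) (c : nat -> R),
    [/\ 0 < r,
        forall n, (0 < n)%N -> homogeneous_polynomial n (P n),
        forall n X, (0 < n)%N -> ideal_sa X ->
          snorm S (P n X) <= c n * snorm S X ^+ n,
        cvgn (series (fun n => c n * r ^+ n))
      & forall X, ideal_sa X -> snorm S X < r ->
          [/\ U (D + X), ideal_sa (F (D + X) - F D)
            & snorm S (F (D + X) - F D - \sum_(1 <= n < k) P n X)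
                @[k --> \oo] --> (0 : R)]].

Definition real_analytic (U : set (H -> H)) (F : (H -> H) -> H -> H) : Prop :=
  forall D, U D -> analytic_at U F D.

Definition pos_inv_translates (C : H -> H) : set (H -> H) :=
  [set D | positive_invertible ip D /\ ideal_set S (D - C)].

End Analytic.

(** [nu] is a measure on the Borel sets of [R] of which only the restriction to
    the open half-line is used.  The last equation holds in the extended reals:
    at [l = 0] it forces the integral of the nonnegative function
    1 / (t * (t ^ 2 + 1)) to be finite, so [f] is continuous on [0, +oo[. *)
Definition loewner_representation (R : realType) (f : R -> R) (alpha beta : R)
    (nu : {measure set R -> \bar R}) : Prop :=
  [/\ 0 <= beta,
      (\int[nu]_(t in `]0%R, +oo[) ((t ^+ 2 + 1)^-1)%R%:E < +oo)%E
    & forall l : R, 0 <= l ->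
        (f l)%:E = ((alpha + beta * l)%R%:E -
          \int[nu]_(t in `]0%R, +oo[) ((t + l)^-1 - t / (t ^+ 2 + 1))%R%:E)%E].

Section Taylor.
Context {R : realType} {H : completeNormedModType R[i]}.
Variables (ip : {dot H for (@Num.conj R[i])}).
Variables (beta : R) (nu : {measure set R -> \bar R}) (C : H -> H).

Definition resolvent (t : R) : H -> H := opinv (t%:C *: idfun + C).

Definition taylor_integrand (n : nat) (X : H -> H) (t : R) : H -> H :=
  iter n (resolvent t \o X) \o resolvent t.

Definition taylor_integral (n : nat) (X : H -> H) : H -> H :=
  weak_integral ip nu `]0, +oo[ (taylor_integrand n X).

Definition taylor_term (n : nat) (X : H -> H) : H -> H :=
  if n == 1%N then beta%:C *: X + taylor_integral 1 X
  else (-1) ^+ n.+1 *: taylor_integral n X.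

End Taylor.

(* Main.v *)
From HB Require Import structures.
Require Import Defs.
From mathcomp Require Import all_boot all_order all_algebra.
From mathcomp Require Import sesquilinear complex ring lra.
From mathcomp Require Import all_classical all_reals all_analysis.
From mathcomp Require Import measurable_realfun.
Import Order.TTheory GRing.Theory Num.Theory.
Import numFieldNormedType.Exports.
Set Implicit Arguments.
Unset Strict Implicit.
Unset Printing Implicit Defensive.
Local Open Scope classical_set_scope.
Local Open Scope ring_scope.
Local Open Scope complex_scope.

(** Everything reduces to one power series with geometric estimates. Fix a
    scalar [c > 0] and write [K = c - C]. Because
    [1 / (t + l) - 1 / (t + c) = sum_j (c - l)^(j+1) / (t + c)^(j+2)],
    integration against [nu] gives
    [f l = f c - sum_j a_j (c - l)^(j+1)] for [|c - l| < c], where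
    [a_j = int (t + c)^-(j+2) dnu + (beta if j = 0)] and [|a_j| <= A / c^j]
    ([loewner_series], [loewner_coef_le]). If [C] is positive and invertible and
    [c >= ||C||], then [||c - C|| < c], and more precisely
    [||c - C|| <= c - min sigma(C)] ([opnorm_scalar_sub]), so the same series in
    [c - C] converges in norm. It is [f(C)]: the partial sums are polynomials
    that converge uniformly on the spectrum ([fcalc_series]), and the functional
    calculus is well defined because the norm of a real polynomial in a
    self-adjoint operator is attained on the spectrum ([polyop_opnorm]).

    For [D = C + X] the series has [(K - X)^j] in place of [K^j]. Expanding the
    noncommutative power by the number of factors [X] gives words in [K] and [X].
    The words with [n] factors [X] sum up to the homogeneous polynomial of degree
    [n], and the words with at least [N] factors [X] form a remainder that
    satisfies the same recursion as the words do ([iter_expansion]). A single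
    estimate for this recursion ([step_bound]) is therefore enough: if
    [||K|| < b < c], then words of length [j] with [n] factors [X] contribute at
    most [(||X||_S / (b - ||K||))^n b^j] in the norm of the ideal, and so does
    the remainder. Summation against the [a_j] leaves
    [O((||X||_S / (b - ||K||))^n)] for the term and for the remainder of degree
    [n] ([taylor_remainder]). When [||X||_S < min sigma(C)] there is a [b < c]
    for which the ratio is below one, which yields the stated radius; for an
    arbitrary [D] in the translate the remainder with [N = 1] still shows that
    [f(D) - f(C)] is in the ideal. Membership in the ideal always comes from
    convergence of these series in the norm of the ideal.

    The formula for the Taylor terms as integrals is obtained pointwise in [t]:
    the recursion of the words says that their generating series in
    [(t + c)^-1] is [((t + C)^-1 X)^n (t + C)^-1] ([integrand_series]), and the
    matrix coefficients of that series may be integrated term by term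
    ([integral_power_series]). *)

(** * Vector norms and bounded operators *)

Section VectorNorm.
Context {R : realType} {H : completeNormedModType R[i]}.
Implicit Types (x y : H) (a : R[i]).

Lemma normr_vnorm x : `|x| = (vnorm x)%:C.
Proof. by rewrite /vnorm RRe_real// normr_real. Qed.

Lemma normc_Re a : `|a| = (complex.Re `|a|)%:C.
Proof. by rewrite RRe_real// normr_real. Qed.

Lemma Re_normc_real (r : R) : complex.Re `|r%:C| = `|r|.
Proof. by rewrite normc_def/= expr0n/= addr0 sqrtr_sqr. Qed.

Lemma Re_normc_ge0 a : 0 <= complex.Re `|a|.
Proof. by rewrite -ler0c -normc_Re. Qed.

Lemma vnorm_ge0 x : 0 <= vnorm x.
Proof. by rewrite -ler0c -normr_vnorm. Qed.

Lemma vnormD x y : vnorm (x + y) <= vnorm x + vnorm y.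
Proof. by rewrite -lecR rmorphD/= -!normr_vnorm ler_normD. Qed.

Lemma vnormZ a x : vnorm (a *: x) = complex.Re `|a| * vnorm x.
Proof.
by apply: (@complexI R); rewrite rmorphM/= -!normr_vnorm -normc_Re normrZ.
Qed.

Lemma vnormZr (r : R) x : vnorm (r%:C *: x) = `|r| * vnorm x.
Proof. by rewrite vnormZ Re_normc_real. Qed.

Lemma vnormN x : vnorm (- x) = vnorm x.
Proof. by rewrite /vnorm normrN. Qed.

Lemma vnormB x y : vnorm (x - y) <= vnorm x + vnorm y.
Proof. by rewrite -[leRHS]/(vnorm x + vnorm y) -(vnormN y) vnormD. Qed.

Lemma vdistC x y : vnorm (x - y) = vnorm (y - x).
Proof. by rewrite -vnormN opprB. Qed.

Lemma vnorm0 : vnorm (0 : H) = 0.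
Proof. by rewrite /vnorm normr0. Qed.

Lemma vnorm_eq0 x : (vnorm x == 0) = (x == 0).
Proof. by rewrite -(normr_eq0 x) normr_vnorm eq_complex/= eqxx andbT. Qed.

Lemma vnorm_gt0 x : (0 < vnorm x) = (x != 0).
Proof. by rewrite lt_def vnorm_eq0 vnorm_ge0 andbT. Qed.

End VectorNorm.

Section BoundedOps.
Context {R : realType} {H : completeNormedModType R[i]}.
Implicit Types (A B T X Y : H -> H) (x y : H).

Section Linear.
Variable A : H -> H.
Hypothesis A_lin : linear A.
#[local] HB.instance Definition _ := GRing.isLinear.Build _ _ _ _ A A_lin.
Let f : {linear H -> H} := A.

Lemma lin0 : A 0 = 0. Proof. exact: (linear0 f). Qed.
Lemma linD x y : A (x + y) = A x + A y. Proof. exact: (linearD f). Qed.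
Lemma linB x y : A (x - y) = A x - A y. Proof. exact: (linearB f). Qed.
Lemma linN x : A (- x) = - A x. Proof. exact: (linearN f). Qed.
Lemma linZ a x : A (a *: x) = a *: A x. Proof. exact: (linearZ_LR f). Qed.
Lemma linS n (F : nat -> H) : A (\sum_(i < n) F i) = \sum_(i < n) A (F i).
Proof. exact: (linear_sum f). Qed.
End Linear.

Lemma bounded_lin A : bounded_op A -> linear A. Proof. by case. Qed.

Lemma opnorm_has_sup A : bounded_op A ->
  has_sup [set vnorm (A x) | x in [set x | vnorm x <= 1]].
Proof.
move=> [lA [M hM]]; split.
  by exists (vnorm (A 0)), 0 => //=; rewrite vnorm0.
exists `|M| => _ [x /= x1 <-]; apply: (le_trans (hM x)).
apply: (le_trans (ler_wpM2r (vnorm_ge0 x) (ler_norm M))).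
by rewrite ler_piMr.
Qed.

Lemma opnorm_ge0 A : bounded_op A -> 0 <= opnorm A.
Proof.
move=> /[dup] [[lA _]] /opnorm_has_sup[_ ub]; apply: (ub_le_sup ub).
by exists 0; rewrite /= ?vnorm0// (lin0 lA) vnorm0.
Qed.

Lemma vnorm_opnorm A x : bounded_op A -> vnorm (A x) <= opnorm A * vnorm x.
Proof.
move=> bA; have [_ ub] := opnorm_has_sup bA; have lA := bounded_lin bA.
have [->|x0] := eqVneq x 0; first by rewrite (lin0 lA) vnorm0 mulr0.
have px : 0 < vnorm x by rewrite vnorm_gt0.
rewrite -ler_pdivrMr// mulrC.
have -> : (vnorm x)^-1 * vnorm (A x) = vnorm (A ((vnorm x)^-1%:C *: x)).
  by rewrite (linZ lA) vnormZr ger0_norm// invr_ge0 vnorm_ge0.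
apply: (ub_le_sup ub); exists ((vnorm x)^-1%:C *: x) => //=.
by rewrite vnormZr ger0_norm ?invr_ge0 ?vnorm_ge0// mulVf// gt_eqF.
Qed.

Lemma opnorm_le A (M : R) : 0 <= M -> (forall x, vnorm (A x) <= M * vnorm x) ->
  opnorm A <= M.
Proof.
move=> M0 hM; apply: ge_sup; first by exists (vnorm (A 0)), 0; rewrite /= ?vnorm0.
by move=> _ [x /= x1 <-]; apply: (le_trans (hM x)); rewrite ler_piMr.
Qed.

Lemma vnorm_opnorm_le A x (M : R) : bounded_op A -> opnorm A <= M ->
  vnorm (A x) <= M * vnorm x.
Proof.
move=> bA h; apply: (le_trans (vnorm_opnorm x bA)).
by rewrite ler_wpM2r// vnorm_ge0.
Qed.

Lemma bounded_op_of_le A (M : R) : linear A ->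
  (forall x, vnorm (A x) <= M * vnorm x) -> bounded_op A.
Proof. by move=> lA hM; split=> //; exists M. Qed.

Lemma bounded0 : bounded_op (0 : H -> H).
Proof.
apply: (@bounded_op_of_le _ 0) => [a x y|x]; rewrite /= ?scaler0 ?addr0//.
by rewrite [X in vnorm X](_ : _ = 0)// vnorm0 mul0r.
Qed.

Lemma bounded_id : bounded_op (idfun : H -> H).
Proof. by apply: (@bounded_op_of_le _ 1) => // x; rewrite mul1r. Qed.

Lemma boundedD A B : bounded_op A -> bounded_op B -> bounded_op (A + B).
Proof.
move=> bA bB; apply: (@bounded_op_of_le _ (opnorm A + opnorm B)) => [a x y|x].
  by rewrite !fctE (bounded_lin bA) (bounded_lin bB) scalerDr addrACA.
rewrite fctE mulrDl; apply: (le_trans (vnormD _ _)).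
by apply: lerD; apply: vnorm_opnorm.
Qed.

Lemma boundedZ a A : bounded_op A -> bounded_op (a *: A).
Proof.
move=> bA; apply: (@bounded_op_of_le _ (complex.Re `|a| * opnorm A)) => [b x y|x].
  by rewrite !fctE (bounded_lin bA) scalerDr !scalerA [b * a]mulrC.
by rewrite fctE vnormZ -mulrA ler_wpM2l ?Re_normc_ge0// vnorm_opnorm.
Qed.

Lemma boundedN A : bounded_op A -> bounded_op (- A).
Proof. by rewrite -scaleN1r; apply: boundedZ. Qed.

Lemma boundedB A B : bounded_op A -> bounded_op B -> bounded_op (A - B).
Proof. by move=> bA bB; apply: boundedD => //; apply: boundedN. Qed.

Lemma bounded_comp A B : bounded_op A -> bounded_op B -> bounded_op (A \o B).
Proof.
move=> bA bB; apply: (@bounded_op_of_le _ (opnorm A * opnorm B)) => [a x y|x] /=.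
  by rewrite (bounded_lin bB) (bounded_lin bA).
apply: (le_trans (vnorm_opnorm _ bA)); rewrite -mulrA.
by rewrite ler_wpM2l ?opnorm_ge0// vnorm_opnorm.
Qed.

Lemma bounded_iter n A : bounded_op A -> bounded_op (iter n A).
Proof.
move=> bA; elim: n => [|n ih]; first exact: bounded_id.
exact: (bounded_comp bA ih).
Qed.

Lemma opnormD A B : bounded_op A -> bounded_op B ->
  opnorm (A + B) <= opnorm A + opnorm B.
Proof.
move=> bA bB; apply: opnorm_le => [|x]; first by rewrite addr_ge0// opnorm_ge0.
rewrite fctE mulrDl; apply: (le_trans (vnormD _ _)).
by apply: lerD; apply: vnorm_opnorm.
Qed.

Lemma opnorm_comp A B : bounded_op A -> bounded_op B ->
  opnorm (A \o B) <= opnorm A * opnorm B.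
Proof.
move=> bA bB; apply: opnorm_le => [|x]; first by rewrite mulr_ge0// opnorm_ge0.
apply: (le_trans (vnorm_opnorm _ bA)); rewrite -mulrA.
by rewrite ler_wpM2l ?opnorm_ge0// vnorm_opnorm.
Qed.

Lemma opnormZ_le a A : bounded_op A ->
  opnorm (a *: A) <= complex.Re `|a| * opnorm A.
Proof.
move=> bA; apply: opnorm_le => [|x].
  by rewrite mulr_ge0 ?Re_normc_ge0 ?opnorm_ge0.
by rewrite fctE vnormZ -mulrA ler_wpM2l ?Re_normc_ge0// vnorm_opnorm.
Qed.

Lemma opnormZ a A : bounded_op A -> opnorm (a *: A) = complex.Re `|a| * opnorm A.
Proof.
move=> bA; apply/eqP; rewrite eq_le opnormZ_le// andTb.
have [->|a0] := eqVneq a 0.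
  by rewrite normr0 raddf0 mul0r; apply/opnorm_ge0/boundedZ.
have na : 0 < complex.Re `|a| by rewrite -ltcR -normc_Re normr_gt0.
rewrite -ler_pdivlMl//; have {1}-> : A = a^-1 *: (a *: A).
  by rewrite scalerA mulVf// scale1r.
apply: (le_trans (opnormZ_le _ (boundedZ _ bA))); rewrite normfV.
suff -> : complex.Re `|a|^-1 = (complex.Re `|a|)^-1 by [].
by rewrite [in LHS]normc_Re -(fmorphV (real_complex R)).
Qed.

Lemma opnormN A : opnorm (- A) = opnorm A.
Proof.
by rewrite /opnorm; congr sup; apply/seteqP; split=> _ [x x1 <-]; exists x => //;
  rewrite fctE vnormN.
Qed.

Lemma opnorm_id_le1 : opnorm (idfun : H -> H) <= 1.
Proof. by apply: opnorm_le => // x; rewrite mul1r. Qed.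

Lemma opnorm0 : opnorm (0 : H -> H) = 0.
Proof.
apply/eqP; rewrite eq_le (opnorm_ge0 bounded0) andbT; apply: opnorm_le => // x.
by rewrite [X in vnorm X](_ : _ = 0)// vnorm0 mul0r.
Qed.

Lemma opnorm_eq0 A : bounded_op A -> opnorm A = 0 -> A = 0.
Proof.
move=> bA A0; apply/funext => x; apply/eqP; rewrite -vnorm_eq0 eq_le vnorm_ge0.
by rewrite andbT (le_trans (vnorm_opnorm x bA))// A0 mul0r.
Qed.

Lemma opnorm_distC A B : opnorm (A - B) = opnorm (B - A).
Proof. by rewrite -opnormN opprB. Qed.

Lemma opnorm_iter n A : bounded_op A -> opnorm (iter n A) <= opnorm A ^+ n.
Proof.
move=> bA; elim: n => [|n ih]; first by rewrite expr0 opnorm_id_le1.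
rewrite exprS; apply: (le_trans (opnorm_comp bA (bounded_iter n bA))).
by rewrite ler_wpM2l// opnorm_ge0.
Qed.

(** Cauchy sequences of operators converge pointwise, and the Cauchy estimate
    passes to the limit: the norm tends to zero as well. *)
Lemma opnorm_complete (A : nat -> H -> H) :
  (forall n, bounded_op (A n)) ->
  (forall e : R, 0 < e -> exists N, forall m n, (N <= m)%N -> (N <= n)%N ->
     opnorm (A m - A n) < e) ->
  exists2 B, bounded_op B & opnorm (A n - B) @[n --> \oo] --> (0 : R).
Proof.
move=> bA cA.
have cvA x : cvgn (fun n => A n x).
  apply/cauchy_cvgP/cauchy_exP => e e0.
  have er : (complex.Re e)%:C = e by rewrite RRe_real// gtr0_real.
  have re0 : 0 < complex.Re e by rewrite -ltcR er.
  have x1 : 0 < vnorm x + 1 by rewrite ltr_wpDl// vnorm_ge0.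
  have [N hN] := cA _ (divr_gt0 re0 x1); exists (A N x), N => //= n Nn.
  rewrite /ball_ -/(A N x - A n x) -ball_normE/= normr_vnorm -er ltcR.
  have -> : A N x - A n x = (A N - A n) x by rewrite !fctE.
  apply: (le_lt_trans (vnorm_opnorm x (boundedB (bA N) (bA n)))).
  have := hN _ _ (leqnn N) Nn; rewrite ltr_pdivlMr// mulrDr mulr1.
  apply: le_lt_trans; rewrite lerDl; exact: opnorm_ge0 (boundedB (bA N) (bA n)).
pose B x := lim (A n x @[n --> \oo]).
have cB x : A n x @[n --> \oo] --> B x by exact: cvA.
have near (e : R) x : 0 < e -> \forall n \near \oo, vnorm (B x - A n x) < e.
  move=> e0; have ec : 0 < e%:C by rewrite ltcR.
  have /cvgrPdist_lt /(_ _ ec) := cB x.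
  by apply: filterS => n; rewrite normr_vnorm ltcR.
have lB : linear B.
  move=> a x y; apply: (@norm_cvg_unique _ _ (A n (a *: x + y) @[n --> \oo])).
    exact: cB.
  have -> : (fun n => A n (a *: x + y)) = (fun n => a *: A n x + A n y).
    by apply/funext => n; rewrite (bounded_lin (bA n)).
  by apply: cvgD; [apply: cvgZr|]; exact: cB.
have key (e : R) : 0 < e -> exists N, forall n x, (N <= n)%N ->
    vnorm (A n x - B x) <= e * vnorm x.
  move=> e0; have [N hN] := cA e e0; exists N => n x Nn.
  apply/ler_addgt0Pr => d d0.
  have [m [Nm hm]] : exists m, (N <= m)%N /\ vnorm (B x - A m x) < d.
    by have [m _ hm] := near _ x d0; exists (maxn N m); split;
      rewrite ?leq_maxl//; apply: hm; rewrite /= leq_maxr.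
  have -> : A n x - B x = (A n - A m) x - (B x - A m x).
    by rewrite !fctE opprB addrA subrK.
  apply: (le_trans (vnormB _ _)); apply: lerD; last exact: ltW.
  exact: (vnorm_opnorm_le _ (boundedB (bA n) (bA m)) (ltW (hN _ _ Nn Nm))).
have bB : bounded_op B.
  have [N hN] := key 1 ltr01.
  apply: (@bounded_op_of_le _ (opnorm (A N) + 1)) => // x.
  have -> : B x = A N x - (A N x - B x) by rewrite opprB addrC subrK.
  apply: (le_trans (vnormB _ _)); rewrite mulrDl; apply: lerD.
    exact: vnorm_opnorm.
  exact: hN.
exists B => //; apply/cvgrPdist_le => e e0.
have [N hN] := key e e0; exists N => // n /= Nn.
rewrite sub0r normrN ger0_norm ?opnorm_ge0//; last exact: boundedB.
by apply: opnorm_le => [|x]; [exact: ltW|exact: hN].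
Qed.

(** The algebra of all bounded operators is itself an instance of a
    symmetrically normed ideal, so estimates proved for a general ideal also
    hold for the operator norm. *)
Definition bounded_ideal : symNormedIdeal H.
Proof.
refine (@SymNormedIdeal R H (@bounded_op R H) (@opnorm R H) _ bounded0 boundedD
  _ opnorm_eq0 opnormZ opnormD opnorm_complete _ _).
- by [].
- by move=> X B Y bX bB bY; apply: bounded_comp => //; apply: bounded_comp.
- move=> X B Y bX bB bY; apply: (le_trans (opnorm_comp (bounded_comp bX bB) bY)).
  by rewrite ler_wpM2r ?opnorm_ge0// opnorm_comp.
- by move=> B [bB _].
Defined.

End BoundedOps.

(** * Inner products and symmetrically normed ideals *)

Section InnerProduct.
Context {R : realType} {H : completeNormedModType R[i]}.
Variable ip : {dot H for (@Num.conj R[i])}.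
Hypothesis H_hilbert : induces_norm ip.
Implicit Types (x y : H) (A B : H -> H).

(** Limits and adjoints are checked on the real part of the inner product only; the
    imaginary part is recovered from it by [ip_rip]. *)
Definition rip x y : R := complex.Re (ip x y).

Lemma ipDl x y z : ip (x + y) z = ip x z + ip y z. Proof. exact: linearDl. Qed.
Lemma ipBl x y z : ip (x - y) z = ip x z - ip y z. Proof. exact: linearBl. Qed.
Lemma ipZl a x z : ip (a *: x) z = a * ip x z. Proof. exact: linearZl_LR. Qed.
Lemma ip0l z : ip 0 z = 0. Proof. exact: linear0l. Qed.
Lemma ipNl x z : ip (- x) z = - ip x z. Proof. exact: linearNl. Qed.
Lemma ipDr x y z : ip z (x + y) = ip z x + ip z y. Proof. exact: linearDr. Qed.
Lemma ipBr x y z : ip z (x - y) = ip z x - ip z y. Proof. exact: linearBr. Qed.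
Lemma ipZr a x z : ip z (a *: x) = Num.conj a * ip z x.
Proof. exact: linearZr_LR. Qed.
Lemma ip0r z : ip z 0 = 0. Proof. exact: linear0r. Qed.
Lemma ipNr x z : ip z (- x) = - ip z x. Proof. exact: linearNr. Qed.
Lemma ipC x y : ip x y = Num.conj (ip y x).
Proof. by rewrite hermC expr0 mul1r. Qed.

Lemma conj_realC (r : R) : Num.conj (r%:C) = r%:C.
Proof. by rewrite conj_Creal// complex_real. Qed.

Lemma ipxx x : ip x x = (vnorm x ^+ 2)%:C.
Proof. by rewrite -H_hilbert normr_vnorm rmorphXn. Qed.

Lemma ripxx x : rip x x = vnorm x ^+ 2.
Proof. by rewrite /rip ipxx. Qed.

Lemma rip0l y : rip 0 y = 0. Proof. by rewrite /rip ip0l. Qed.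
Lemma ripDl x y z : rip (x + y) z = rip x z + rip y z.
Proof. by rewrite /rip ipDl raddfD. Qed.
Lemma ripBl x y z : rip (x - y) z = rip x z - rip y z.
Proof. by rewrite /rip ipBl raddfB. Qed.
Lemma ripBr x y z : rip z (x - y) = rip z x - rip z y.
Proof. by rewrite /rip ipBr raddfB. Qed.
Lemma ripZl (r : R) x y : rip (r%:C *: x) y = r * rip x y.
Proof. by rewrite /rip ipZl; case: (ip x y) => a b /=; rewrite mul0r subr0. Qed.
Lemma ripZr (r : R) x y : rip x (r%:C *: y) = r * rip x y.
Proof.
by rewrite /rip ipZr conj_realC; case: (ip x y) => a b /=; rewrite mul0r subr0.
Qed.
Lemma ripC x y : rip x y = rip y x.
Proof. by rewrite /rip ipC; case: (ip y x). Qed.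
Lemma rip_suml n (F : nat -> H) y :
  rip (\sum_(i < n) F i) y = \sum_(i < n) rip (F i) y.
Proof.
elim: n => [|n ih]; first by rewrite !big_ord0 rip0l.
by rewrite !big_ord_recr/= ripDl ih.
Qed.

Lemma Im_ip x y : complex.Im (ip x y) = rip (- 'i *: x) y.
Proof.
by rewrite /rip ipZl; case: (ip x y) => a b /=; rewrite oppr0 mul0r mulN1r opprK add0r.
Qed.

Lemma ip_rip x y : ip x y = rip x y +i* rip (- 'i *: x) y.
Proof. by rewrite -Im_ip /rip; case: (ip x y). Qed.

Lemma vnorm_sqB x y : vnorm (x - y) ^+ 2 = vnorm x ^+ 2 - 2 * rip x y + vnorm y ^+ 2.
Proof. by rewrite -!ripxx ripBl !ripBr (ripC y x); ring. Qed.

(** The square of the norm of [|y|^2 x - <x, y> y] is nonnegative. *)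
Lemma cauchy_schwarz x y : complex.Re `|ip x y| <= vnorm x * vnorm y.
Proof.
have [->|y0] := eqVneq y 0; first by rewrite ip0r normr0 raddf0 vnorm0 mulr0.
have py : 0 < vnorm y by rewrite vnorm_gt0.
set z := ip x y; set n := complex.Re `|z|.
have nz : z * Num.conj z = (n ^+ 2)%:C by rewrite -normCK normc_Re rmorphXn.
have : 0 <= vnorm (((vnorm y ^+ 2)%:C *: x) - z *: y) ^+ 2 by exact: sqr_ge0.
rewrite vnorm_sqB !vnormZ Re_normc_real -/n ger0_norm ?sqr_ge0// ripZl.
have -> : rip x (z *: y) = n ^+ 2.
  by rewrite /rip ipZr -/z mulrC nz.
move=> h; rewrite -(@ler_pXn2r _ 2)// ?nnegrE ?Re_normc_ge0 ?mulr_ge0 ?vnorm_ge0//.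
rewrite exprMn -(ler_pM2l (exprn_gt0 2 py)) -subr_ge0.
by apply: le_trans h _; rewrite le_eqVlt; apply/orP; left; apply/eqP; ring.
Qed.

Lemma rip_le x y : `|rip x y| <= vnorm x * vnorm y.
Proof.
apply: le_trans (cauchy_schwarz x y).
by rewrite -lecR -normc_Re; exact: normc_ge_Re.
Qed.

Lemma ip_ext x : (forall y, rip x y = 0) -> x = 0.
Proof. by move/(_ x)/eqP; rewrite ripxx sqrf_eq0 vnorm_eq0 => /eqP. Qed.

Definition rank_one_op (u v : H) : H -> H := fun x => ip x u *: v.

Lemma vnorm_rank_one_op u v x :
  vnorm (rank_one_op u v x) <= (vnorm u * vnorm v) * vnorm x.
Proof.
rewrite vnormZ; have := ler_wpM2r (vnorm_ge0 v) (cauchy_schwarz x u); lra.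
Qed.

Lemma bounded_rank_one_op u v : bounded_op (rank_one_op u v).
Proof.
apply: (bounded_op_of_le _ (@vnorm_rank_one_op u v)) => a x y.
by rewrite /rank_one_op ipDl ipZl scalerDl scalerA.
Qed.

Lemma rank_one_rank_one_op u v : u != 0 -> v != 0 -> rank_one (rank_one_op u v).
Proof.
move=> u0 v0; split; first exact: bounded_rank_one_op.
exists v => //; apply/seteqP; split => [_ [x _ <-]|_ [c _ <-]]; first by exists (ip x u).
exists ((c / ip u u) *: u) => //; rewrite /rank_one_op ipZl divfK//.
by rewrite ipxx fmorph_eq0 sqrf_eq0 vnorm_eq0.
Qed.

Variable S : symNormedIdeal H.
Let snorm := snorm S.
Let ideal := ideal_set S.

Lemma ideal_comp X B : bounded_op X -> ideal B -> ideal (X \o B).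
Proof. by move=> bX iB; exact: (ideal_mul bX iB bounded_id). Qed.

Lemma ideal_compr B Y : ideal B -> bounded_op Y -> ideal (B \o Y).
Proof. by move=> iB bY; exact: (ideal_mul bounded_id iB bY). Qed.

Lemma idealZ a B : ideal B -> ideal (a *: B).
Proof.
move=> iB; have := ideal_comp (boundedZ a bounded_id) iB.
by congr ideal.
Qed.

Lemma idealN B : ideal B -> ideal (- B).
Proof. by rewrite -scaleN1r; apply: idealZ. Qed.

Lemma idealB A B : ideal A -> ideal B -> ideal (A - B).
Proof. by move=> iA iB; apply: ideal_add => //; apply: idealN. Qed.

Lemma ideal_sum n (F : nat -> H -> H) :
  (forall i, ideal (F i)) -> ideal (\sum_(i < n) F i).
Proof.
move=> iF; elim: n => [|n ih]; first by rewrite big_ord0; exact: ideal0.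
by rewrite big_ord_recr/=; exact: (ideal_add ih (iF n)).
Qed.

Lemma snorm0 : snorm 0 = 0.
Proof.
have := snormZ 0 (ideal0 S); rewrite scaler0 /snorm => ->.
by rewrite normr0 raddf0 mul0r.
Qed.

Lemma snormN B : ideal B -> snorm (- B) = snorm B.
Proof. by move=> iB; rewrite -scaleN1r /snorm snormZ// normrN1 /= mul1r. Qed.

Lemma snormZr (r : R) B : ideal B -> snorm (r%:C *: B) = `|r| * snorm B.
Proof. by move=> iB; rewrite /snorm snormZ// Re_normc_real. Qed.

Lemma snorm_ge0 B : ideal B -> 0 <= snorm B.
Proof.
move=> iB; have := snorm_triangle iB (idealN iB).
by rewrite subrr -/snorm snorm0 snormN// -mulr2n pmulrn_lge0.
Qed.

Lemma snormB A B : ideal A -> ideal B -> snorm (A - B) <= snorm A + snorm B.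
Proof.
by move=> iA iB; rewrite -(snormN iB); exact: (snorm_triangle iA (idealN iB)).
Qed.

Lemma snorm_comp X B : bounded_op X -> ideal B ->
  snorm (X \o B) <= opnorm X * snorm B.
Proof.
move=> bX iB; apply: (le_trans (snorm_mul bX iB bounded_id)).
rewrite ler_piMr ?opnorm_id_le1// mulr_ge0 ?opnorm_ge0//; exact: snorm_ge0.
Qed.

Lemma snorm_compr B Y : ideal B -> bounded_op Y ->
  snorm (B \o Y) <= snorm B * opnorm Y.
Proof.
move=> iB bY; apply: (le_trans (snorm_mul bounded_id iB bY)).
rewrite ler_wpM2r ?opnorm_ge0// ler_piMl ?opnorm_id_le1//; exact: snorm_ge0.
Qed.

(** Sandwiching [B] between the rank-one operators carried by [B x] and by [x]
    produces a multiple of a single rank-one operator, on which the two norms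
    agree. *)
Lemma opnorm_le_snorm B : ideal B -> opnorm B <= snorm B.
Proof.
move=> iB; have bB := ideal_bounded iB.
apply: opnorm_le => [|x]; first exact: snorm_ge0.
have [Bx0|y0] := eqVneq (B x) 0.
  by rewrite Bx0 vnorm0 mulr_ge0 ?vnorm_ge0//; exact: snorm_ge0.
have x0 : x != 0.
  by apply: contra_neq y0 => ->; exact: (lin0 (bounded_lin bB)).
set y := B x in y0 *; pose P := rank_one_op y y; pose Q := rank_one_op x x.
have px : 0 < vnorm x by rewrite vnorm_gt0.
have py : 0 < vnorm y by rewrite vnorm_gt0.
have bP : bounded_op P := bounded_rank_one_op y y.
have bQ : bounded_op Q := bounded_rank_one_op x x.
have PBQ : P \o B \o Q = rank_one_op x ((vnorm y ^+ 2)%:C *: y).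
  apply/funext => u; rewrite /= /P /Q /rank_one_op (linZ (bounded_lin bB)) ipZl.
  by rewrite -/y ipxx scalerA.
have [_ nE] : ideal (P \o B \o Q) /\ snorm (P \o B \o Q) = opnorm (P \o B \o Q).
  rewrite PBQ; apply/snorm_rank_one/rank_one_rank_one_op => //.
  by rewrite scaler_eq0 negb_or y0 andbT fmorph_eq0 sqrf_eq0 vnorm_eq0.
have lower : vnorm y ^+ 2 * vnorm y * vnorm x ^+ 2 <= opnorm (P \o B \o Q) * vnorm x.
  apply: (le_trans _ (vnorm_opnorm x (bounded_comp (bounded_comp bP bB) bQ))).
  rewrite PBQ /rank_one_op vnormZ vnormZr ipxx Re_normc_real !ger0_norm ?sqr_ge0//.
  by rewrite mulrC.
have upper : opnorm (P \o B \o Q) <= vnorm y ^+ 2 * snorm B * vnorm x ^+ 2.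
  rewrite -nE; apply: (le_trans (snorm_mul bP iB bQ)).
  apply: ler_pM; rewrite ?opnorm_ge0//.
  - by rewrite mulr_ge0 ?opnorm_ge0//; exact: snorm_ge0.
  - apply: ler_wpM2r; first exact: snorm_ge0.
    by apply: opnorm_le => [|u]; rewrite ?sqr_ge0// expr2 vnorm_rank_one_op.
  - by apply: opnorm_le => [|u]; rewrite ?sqr_ge0// expr2 vnorm_rank_one_op.
have := le_trans lower (ler_wpM2r (ltW px) upper).
move=> h; rewrite -(ler_pM2l (exprn_gt0 2 py)) -(ler_pM2r (exprn_gt0 2 px)); lra.
Qed.

End InnerProduct.

(** * Norm-convergent series of operators *)

Section OperatorSeries.
Context {R : realType} {H : completeNormedModType R[i]}.
Implicit Types (x y : H) (A B : nat -> H -> H) (T U X : H -> H).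

Lemma cvg0_le (u v : nat -> R) : (forall n, 0 <= u n <= v n) ->
  v n @[n --> \oo] --> 0 -> u n @[n --> \oo] --> 0.
Proof. by move=> uv; apply: squeeze_cvgr (cvg_cst 0); exact: nearW. Qed.

(** Convergence is in operator norm even for series of elements of an ideal; as
    the norm of the ideal dominates the operator norm, a limit in the ideal is
    the same operator. *)
Definition sums_to A T := [/\ forall j, bounded_op (A j), bounded_op T &
  opnorm (\sum_(j < J) A j - T) @[J --> \oo] --> (0 : R)].

Definition opsum A : H -> H := xget 0 [set T | sums_to A T].

Lemma sum_ffunE n (F : nat -> H -> H) x : (\sum_(i < n) F i) x = \sum_(i < n) F i x.
Proof. by elim/big_rec2: _ => // i _ f _ <-. Qed.

Lemma bounded_sum n (F : nat -> H -> H) :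
  (forall i, bounded_op (F i)) -> bounded_op (\sum_(i < n) F i).
Proof. exact: (ideal_sum (S := bounded_ideal)). Qed.

Lemma sums_to_bounded_diff A T J : sums_to A T ->
  bounded_op (\sum_(j < J) A j - T).
Proof. by case=> bA bT _; apply: boundedB => //; exact: bounded_sum. Qed.

Lemma sums_to_ptwise A T x : sums_to A T ->
  vnorm (\sum_(j < J) A j x - T x) @[J --> \oo] --> (0 : R).
Proof.
move=> sA; have [_ _ cT] := sA; apply: (@cvg0_le _ (fun J =>
    opnorm (\sum_(j < J) A j - T) * vnorm x)) => [n|].
  rewrite vnorm_ge0/=; have := vnorm_opnorm x (sums_to_bounded_diff n sA).
  by rewrite !fctE sum_ffunE.
by rewrite -[X in _ --> X](mul0r (vnorm x)); exact: cvgMl.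
Qed.

Lemma sums_to_ptwise_unique A T x v : sums_to A T ->
  vnorm (\sum_(j < J) A j x - v) @[J --> \oo] --> (0 : R) -> v = T x.
Proof.
move=> sA cv; have cT := sums_to_ptwise x sA.
apply/eqP; rewrite -subr_eq0 -vnorm_eq0 eq_le vnorm_ge0 andbT.
have c0 : vnorm (\sum_(j < J) A j x - T x) + vnorm (\sum_(j < J) A j x - v)
    @[J --> \oo] --> (0 : R) by rewrite -[X in _ --> X](addr0 0); exact: cvgD.
apply: (ler_cvg_to (cvg_cst (vnorm (v - T x))) c0); apply: nearW => J.
set s := \sum_(j < J) _; rewrite (vdistC s v) [leRHS]addrC.
by have -> : v - T x = (v - s) + (s - T x); [rewrite addrA subrK|exact: vnormD].
Qed.

Lemma sums_to_unique A T U : sums_to A T -> sums_to A U -> T = U.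
Proof.
move=> sT sU; apply/funext => x; apply: (sums_to_ptwise_unique sU).
exact: sums_to_ptwise.
Qed.

Lemma opsumE A T : sums_to A T -> opsum A = T.
Proof. by move=> sT; apply: (xget_unique 0 sT) => U sU; exact: sums_to_unique sT. Qed.

Lemma sums_toD A B T U : sums_to A T -> sums_to B U ->
  sums_to (fun j => A j + B j) (T + U).
Proof.
move=> sA sB; have [bA bT cT] := sA; have [bB bU cU] := sB.
split=> [j||]; [exact: boundedD|exact: boundedD|].
apply: (@cvg0_le _ (fun J => opnorm (\sum_(j < J) A j - T) +
    opnorm (\sum_(j < J) B j - U))) => [J|]; last first.
  by rewrite -[X in _ --> X](addr0 0); exact: cvgD.
have -> : \sum_(j < J) (A j + B j) - (T + U) =
    (\sum_(j < J) A j - T) + (\sum_(j < J) B j - U).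
  by rewrite big_split/= opprD addrACA.
have bAJ := sums_to_bounded_diff J sA; have bBJ := sums_to_bounded_diff J sB.
by rewrite opnormD// opnorm_ge0//; exact: boundedD.
Qed.

Lemma sums_to_comp A T X : bounded_op X -> sums_to A T ->
  sums_to (fun j => X \o A j) (X \o T).
Proof.
move=> bX sA; have [bA bT cT] := sA.
split=> [j||]; [exact: bounded_comp|exact: bounded_comp|].
apply: (@cvg0_le _ (fun J => opnorm X * opnorm (\sum_(j < J) A j - T)))
    => [J|]; last first.
  by rewrite -[X in _ --> X](mulr0 (opnorm X)); exact: cvgMr.
have -> : \sum_(j < J) (X \o A j) - (X \o T) = X \o (\sum_(j < J) A j - T).
  apply/funext => x; rewrite !fctE (sum_ffunE _ A) (sum_ffunE _ (fun j => X \o A j)).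
  by rewrite (linB (bounded_lin bX)) (linS (bounded_lin bX) J (A^~ x)).
have bAJ := sums_to_bounded_diff J sA.
by rewrite opnorm_comp// opnorm_ge0//; exact: bounded_comp.
Qed.

Lemma sums_toZ a A T : sums_to A T -> sums_to (fun j => a *: A j) (a *: T).
Proof. exact: (sums_to_comp (boundedZ a bounded_id)). Qed.

Lemma sums_toN A T : sums_to A T -> sums_to (fun j => - A j) (- T).
Proof.
move=> /(sums_toZ (-1)); rewrite scaleN1r; congr sums_to.
by apply/funext => j; rewrite scaleN1r.
Qed.

Lemma sums_to_compr A T X : bounded_op X -> sums_to A T ->
  sums_to (fun j => A j \o X) (T \o X).
Proof.
move=> bX sA; have [bA bT cT] := sA.
split=> [j||]; [exact: bounded_comp|exact: bounded_comp|].
apply: (@cvg0_le _ (fun J => opnorm (\sum_(j < J) A j - T) * opnorm X))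
    => [J|]; last first.
  by rewrite -[X in _ --> X](mul0r (opnorm X)); exact: cvgMl.
have -> : \sum_(j < J) (A j \o X) - (T \o X) = (\sum_(j < J) A j - T) \o X.
  by apply/funext => x; rewrite !fctE (sum_ffunE _ A) (sum_ffunE _ (fun j => A j \o X)).
have bAJ := sums_to_bounded_diff J sA.
by rewrite opnorm_comp// opnorm_ge0//; exact: bounded_comp.
Qed.

Lemma sums_to_shift A T : sums_to A T -> sums_to (fun j => A j.+1) (T - A 0%N).
Proof.
move=> [bA bT cT]; split=> //; first exact: boundedB.
have -> : (fun J => opnorm (\sum_(j < J) A j.+1 - (T - A 0%N))) =
    (fun J => opnorm (\sum_(j < J.+1) A j - T)).
  by apply/funext => J; rewrite big_ord_recl/= opprB addrA [A 0%N + _]addrC.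
by rewrite -(cvg_shiftS (fun J => opnorm (\sum_(j < J) A j - T))) in cT.
Qed.

Lemma sums_to_shift0 A T : A 0%N = 0 -> sums_to A T -> sums_to (fun j => A j.+1) T.
Proof. by move=> A0 /sums_to_shift; rewrite A0 subr0. Qed.

Section Geometric.
Variable ip : {dot H for (@Num.conj R[i])}.
Hypothesis H_hilbert : induces_norm ip.
Variable S : symNormedIdeal H.

Lemma snorm_sum_geo A (M q : R) m n : 0 <= q < 1 ->
  (forall j, ideal_set S (A j)) -> (forall j, snorm S (A j) <= M * q ^+ j) ->
  snorm S (\sum_(j < m + n) A j - \sum_(j < m) A j) <= M * q ^+ m / (1 - q).
Proof.
move=> /andP[q0 q1] iA nA; have q1' : 0 < 1 - q by rewrite subr_gt0.
have M0 : 0 <= M.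
  by have := le_trans (snorm_ge0 (iA 0%N)) (nA 0%N); rewrite expr0 mulr1.
suff : snorm S (\sum_(j < m + n) A j - \sum_(j < m) A j) <=
    M * (q ^+ m - q ^+ (m + n)) / (1 - q).
  move=> /le_trans; apply; rewrite ler_wpM2r ?invr_ge0 ?(ltW q1')//.
  by rewrite ler_wpM2l// gerBl exprn_ge0.
elim: n => [|n ih]; first by rewrite addn0 !subrr mulr0 mul0r snorm0.
rewrite addnS big_ord_recr/= addrAC.
have iD : ideal_set S (\sum_(j < m + n) A j - \sum_(j < m) A j).
  by apply: idealB; exact: ideal_sum.
apply: (le_trans (snorm_triangle iD (iA _))).
apply: (le_trans (lerD ih (nA _))); rewrite le_eqVlt; apply/orP; left; apply/eqP.
by rewrite exprS; field; rewrite gt_eqF.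
Qed.

Lemma geo_to0 (M q : R) : 0 <= q < 1 -> M * q ^+ n / (1 - q) @[n --> \oo] --> 0.
Proof.
move=> /andP[q0 q1]; rewrite -[X in _ --> X](mul0r (1 - q)^-1); apply: cvgMl.
by apply: cvg_geometric; rewrite ger0_norm.
Qed.

(** Geometric majorants are the only source of convergence below, and the
    explicit tail gives the size of the remainders. *)
Lemma geo_sums A (M q : R) : 0 <= q < 1 ->
  (forall j, ideal_set S (A j)) -> (forall j, snorm S (A j) <= M * q ^+ j) ->
  [/\ ideal_set S (opsum A), sums_to A (opsum A) &
    forall J, snorm S (\sum_(j < J) A j - opsum A) <= M * q ^+ J / (1 - q)].
Proof.
move=> q01 iA nA; have geo := snorm_sum_geo _ _ q01 iA nA.
have iS n : ideal_set S (\sum_(j < n) A j) by exact: ideal_sum.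
have [T iT cT] : exists2 T, ideal_set S T &
    snorm S (\sum_(j < n) A j - T) @[n --> \oo] --> (0 : R).
  apply: snorm_complete => // e e0.
  have e2 : 0 < e / 2 by rewrite divr_gt0.
  have /cvgrPdist_lt /(_ _ e2) [N _ hN] := geo_to0 M q01; exists N => m n Nm Nn.
  have half k : (N <= k)%N -> snorm S (\sum_(j < k) A j - \sum_(j < N) A j) < e / 2.
    move=> Nk; rewrite -(subnKC Nk); apply: (le_lt_trans (geo N _)).
    by apply: le_lt_trans (hN N (leqnn N)); rewrite sub0r normrN ler_norm.
  have -> : \sum_(j < m) A j - \sum_(j < n) A j =
      (\sum_(j < m) A j - \sum_(j < N) A j) - (\sum_(j < n) A j - \sum_(j < N) A j).
    by rewrite opprB addrA subrK.
  apply: (le_lt_trans (snormB (idealB (iS _) (iS _)) (idealB (iS _) (iS _)))).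
  by rewrite (splitr e) ltrD// half.
have sT : sums_to A T.
  split; [by move=> j; exact: (ideal_bounded (iA j))|exact: (ideal_bounded iT)|].
  apply: cvg0_le cT => n; rewrite opnorm_ge0/=; last first.
    exact: (ideal_bounded (idealB (iS n) iT)).
  exact: (opnorm_le_snorm H_hilbert (idealB (iS n) iT)).
rewrite (opsumE sT); split=> // J.
have cJ : snorm S (\sum_(j < n) A j - T) + M * q ^+ J / (1 - q)
    @[n --> \oo] --> (0 + M * q ^+ J / (1 - q)) by apply: cvgD => //; exact: cvg_cst.
rewrite -[leRHS]add0r; apply: (ler_cvg_to (cvg_cst _) cJ).
exists J => // n /= Jn.
have -> : \sum_(j < J) A j - T =
    (\sum_(j < n) A j - T) - (\sum_(j < n) A j - \sum_(j < J) A j).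
  by rewrite opprB [RHS]addrC addrA subrK.
apply: (le_trans (snormB (idealB (iS _) iT) (idealB (iS _) (iS _)))).
by rewrite lerD2l -(subnKC Jn); exact: geo.
Qed.

Lemma snorm_opsum_le A (M q : R) : 0 <= q < 1 ->
  (forall j, ideal_set S (A j)) -> (forall j, snorm S (A j) <= M * q ^+ j) ->
  snorm S (opsum A) <= M / (1 - q).
Proof.
move=> q01 iA nA; have [iT _ /(_ 0%N)] := geo_sums q01 iA nA.
by rewrite big_ord0 sub0r snormN// expr0 mulr1.
Qed.

End Geometric.
End OperatorSeries.

Section AdjointPairs.
Context {R : realType} {H : completeNormedModType R[i]}.
Variable ip : {dot H for (@Num.conj R[i])}.
Hypothesis H_hilbert : induces_norm ip.
Implicit Types (x y : H) (A B : nat -> H -> H) (T U X : H -> H).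

(** Adjoints are handled as a relation between two given operators, which avoids
    the representation theorem for functionals: all operators that occur come
    with an explicit adjoint. *)
Definition adjoint_pair T U := forall x y, ip (T x) y = ip x (U y).

Lemma adjoint_rip T U x y : adjoint_pair T U -> rip ip (T x) y = rip ip x (U y).
Proof. by rewrite /rip => ->. Qed.

Lemma adjoint_of_rip T U : linear T ->
  (forall x y, rip ip (T x) y = rip ip x (U y)) -> adjoint_pair T U.
Proof. by move=> lT h x y; rewrite !ip_rip h -(linZ lT) h. Qed.

Lemma sums_to_rip A T x y : sums_to A T ->
  \sum_(j < J) rip ip (A j x) y @[J --> \oo] --> rip ip (T x) y.
Proof.
move=> sA.
have c0 : vnorm (\sum_(j < J) A j x - T x) * vnorm y @[J --> \oo] --> (0 : R).
  by rewrite -[X in _ --> X](mul0r (vnorm y)); apply: cvgMl; exact: sums_to_ptwise.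
apply/cvgrPdist_le => e e0; have /cvgrPdist_le /(_ e e0) := c0.
apply: filterS => J; rewrite sub0r normrN; apply: le_trans.
rewrite -(rip_suml ip J (fun j => A j x)) distrC -ripBl; apply: le_trans (ler_norm _).
exact: rip_le.
Qed.

Lemma sums_to_adjoint A B T U : sums_to A T -> sums_to B U ->
  (forall j, adjoint_pair (A j) (B j)) -> adjoint_pair T U.
Proof.
move=> sA sB AB; have [_ bT _] := sA; apply: adjoint_of_rip => [|x y].
  exact: bounded_lin.
have cA := @sums_to_rip _ _ x y sA; have := @sums_to_rip _ _ y x sB.
have -> : (fun J => \sum_(j < J) rip ip (B j y) x) =
    (fun J => \sum_(j < J) rip ip (A j x) y).
  apply/funext => J; apply: eq_bigr => j _.
  by rewrite ripC (adjoint_rip x y (AB j)).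
by move=> cB; rewrite [RHS]ripC; apply: cvg_unique cA cB.
Qed.

End AdjointPairs.

(** * Inverses and the Neumann series *)

Section Inverses.
Context {R : realType} {H : completeNormedModType R[i]}.
Implicit Types (x y : H) (A B U V G K : H -> H) (a z : R[i]).

Lemma op_inverse_unique A B B' : is_op_inverse A B -> is_op_inverse A B' -> B = B'.
Proof.
move=> [_ AB BA] [_ AB' BA']; apply/funext => x.
have e1 : A (B' x) = x by have /(congr1 (fun g => g x))/= := AB'.
by have /(congr1 (fun g => g (B' x)))/= := BA; rewrite e1.
Qed.

Lemma opinvE A B : is_op_inverse A B -> opinv A = B.
Proof. by move=> AB; apply: (xget_unique 0 AB) => B' AB'; exact: op_inverse_unique AB. Qed.

Lemma op_invertible_comp U V : op_invertible U -> op_invertible V ->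
  op_invertible (U \o V).
Proof.
move=> [G [bG UG GU]] [K [bK VK KV]]; exists (K \o G); split.
- exact: bounded_comp.
- apply/funext => x /=; have /(congr1 (fun g => g (G x)))/= -> := VK.
  by have /(congr1 (fun g => g x))/= -> := UG.
- apply/funext => x /=; have /(congr1 (fun g => g (V x)))/= -> := GU.
  by have /(congr1 (fun g => g x))/= -> := KV.
Qed.

Lemma op_invertibleN U : linear U -> op_invertible U -> op_invertible (- U).
Proof.
move=> lU [G [bG UG GU]]; exists (- G); split; first exact: boundedN.
- apply/funext => x; rewrite !fctE (linN lU) opprK.
  by have /(congr1 (fun g => g x))/= -> := UG.
- apply/funext => x; rewrite !fctE (linN (bounded_lin bG)) opprK.
  by have /(congr1 (fun g => g x))/= -> := GU.
Qed.

Lemma op_invertible_scale a : a != 0 -> op_invertible (a *: idfun : H -> H).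
Proof.
move=> a0; exists (a^-1 *: idfun); split; first exact/boundedZ/bounded_id.
- by apply/funext => x; rewrite !fctE scalerA mulfV// scale1r.
- by apply/funext => x; rewrite !fctE scalerA mulVf// scale1r.
Qed.

(** [V] times the inverse of [U V] is a right inverse of [U], and it is also a left
    inverse because [V] commutes with [U V]. *)
Lemma op_invertible_factor U V : bounded_op V ->
  U \o V = V \o U -> op_invertible (U \o V) -> op_invertible U.
Proof.
move=> bV UV [G [bG UVG GUV]]; exists (V \o G); split.
- exact: bounded_comp.
- exact: UVG.
have -> : V \o G = G \o V.
  apply/funext => x /=.
  have <- : G (U (V (V (G x)))) = V (G x).
    by have /(congr1 (fun g => g (V (G x))))/= := GUV.
  have E y : U (V y) = V (U y) by have /(congr1 (fun g => g y))/= := UV.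
  rewrite E; congr (G (V _)).
  by have /(congr1 (fun g => g x))/= := UVG.
apply/funext => x /=.
have <- : U (V x) = V (U x) by have /(congr1 (fun g => g x))/= := UV.
by have /(congr1 (fun g => g x))/= := GUV.
Qed.

End Inverses.

Section Neumann.
Context {R : realType} {H : completeNormedModType R[i]}.
Variable ip : {dot H for (@Num.conj R[i])}.
Hypothesis H_hilbert : induces_norm ip.
Implicit Types (K : H -> H).

Definition scalar_op (c : R) : H -> H := c%:C *: idfun.

Lemma bounded_scalar c : bounded_op (scalar_op c).
Proof. exact/boundedZ/bounded_id. Qed.

(** Multiplying the terms of the series by [m] shifts the powers of [K] by one, so
    that the sum [G] satisfies [m G - 1 = K G = G K]. *)
Lemma neumann K (m : R) : bounded_op K -> opnorm K < m ->
  exists2 G, is_op_inverse (scalar_op m - K) G &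
    sums_to (fun j => ((m^-1) ^+ j.+1)%:C *: iter j K) G.
Proof.
move=> bK Km; have m0 : 0 < m := le_lt_trans (opnorm_ge0 bK) Km.
have q01 : 0 <= opnorm K / m < 1.
  by rewrite divr_ge0 ?opnorm_ge0 ?(ltW m0)//= ltr_pdivrMr// mul1r.
pose A j := ((m^-1) ^+ j.+1)%:C *: iter j K.
have bA j : bounded_op (A j) by apply/boundedZ/bounded_iter.
have nA j : opnorm (A j) <= m^-1 * (opnorm K / m) ^+ j.
  rewrite /A opnormZ; last exact: bounded_iter.
  rewrite Re_normc_real ger0_norm; last by rewrite exprn_ge0// invr_ge0 ltW.
  rewrite exprS -mulrA; apply: ler_wpM2l; first by rewrite invr_ge0 ltW.
  rewrite expr_div_n mulrC exprVn ler_wpM2r ?invr_ge0 ?exprn_ge0 ?(ltW m0)//.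
  exact: opnorm_iter.
have [bG sG _] := geo_sums H_hilbert (S := bounded_ideal) q01 bA nA.
set G := opsum A in bG sG; exists G => //.
have sG' := sums_toZ m%:C (sums_to_shift sG).
have E j : m%:C *: A j.+1 = K \o A j.
  apply/funext => x; rewrite /A !fctE/= scalerA (linZ (bounded_lin bK)) -rmorphM.
  by rewrite exprS mulrA mulfV ?mul1r// gt_eqF.
have E' j : m%:C *: A j.+1 = A j \o K.
  apply/funext => x; rewrite /A !fctE iterSr scalerA -rmorphM.
  by rewrite exprS mulrA mulfV ?mul1r// gt_eqF.
have GE : m%:C *: (G - A 0%N) = m%:C *: G - idfun.
  rewrite scalerBr; congr (_ - _); apply/funext => x.
  by rewrite /A expr1 !fctE scalerA -rmorphM mulfV ?gt_eqF// scale1r.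
have KG : K \o G = m%:C *: G - idfun.
  rewrite -GE; apply: (sums_to_unique _ sG').
  by rewrite (funext E); exact: sums_to_comp.
have GK : G \o K = m%:C *: G - idfun.
  rewrite -GE; apply: (sums_to_unique _ sG').
  by rewrite (funext E'); exact: sums_to_compr.
split=> //; apply/funext => x.
- have := congr1 (fun g => g x) KG; rewrite /scalar_op !fctE => ->.
  by rewrite opprB addrC subrK.
- have := congr1 (fun g => g x) GK; rewrite /scalar_op !fctE => GKx.
  by rewrite (linB (bounded_lin bG)) (linZ (bounded_lin bG)) GKx opprB addrC subrK.
Qed.

Lemma neumann_invertible D (c : R) : bounded_op D -> opnorm (scalar_op c - D) < c ->
  op_invertible D.
Proof.
move=> bD Dc; have [G + _] := neumann (boundedB (bounded_scalar c) bD) Dc.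
by rewrite opprB addrC subrK; exists G.
Qed.

Lemma spectrum_bounded (A : H -> H) (l : R) : bounded_op A -> real_spectrum A l ->
  `|l| <= opnorm A.
Proof.
move=> bA; apply: contra_notT; rewrite -ltNge real_ltr_normr ?num_real// => /orP[h|h].
  have [G iG _] := neumann bA h; rewrite -opprB.
  by apply: op_invertibleN; [apply/bounded_lin/boundedB => //; exact: bounded_scalar|exists G].
have [G iG _] : exists2 G, is_op_inverse (scalar_op (- l) - (- A)) G & True.
  by rewrite -opnormN in h; have [G] := neumann (boundedN bA) h; exists G.
exists G; suff -> : A - l%:C *: idfun = scalar_op (- l) - - A by [].
by rewrite /scalar_op rmorphN scaleNr opprK addrC.
Qed.

End Neumann.

(** * Self-adjoint operators *)

Section SelfAdjoint.
Context {R : realType} {H : completeNormedModType R[i]}.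
Variable ip : {dot H for (@Num.conj R[i])}.
Hypothesis H_hilbert : induces_norm ip.
Implicit Types (A B U D : H -> H) (x y : H).

Lemma sa_rip A x y : selfadjoint ip A -> rip ip (A x) y = rip ip x (A y).
Proof. by rewrite /rip => ->. Qed.

Lemma adjoint_pairD A B U V : adjoint_pair ip A B -> adjoint_pair ip U V ->
  adjoint_pair ip (A + U) (B + V).
Proof. by move=> AB UV x y; rewrite !fctE ipDl ipDr AB UV. Qed.

Lemma adjoint_pairZ (r : R) A B : adjoint_pair ip A B ->
  adjoint_pair ip (r%:C *: A) (r%:C *: B).
Proof. by move=> AB x y; rewrite !fctE ipZl ipZr conj_realC AB. Qed.

Lemma adjoint_pair_comp A B U V : adjoint_pair ip A B -> adjoint_pair ip U V ->
  adjoint_pair ip (A \o U) (V \o B).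
Proof. by move=> AB UV x y; rewrite !fctE AB UV. Qed.

Lemma saD A B : selfadjoint ip A -> selfadjoint ip B -> selfadjoint ip (A + B).
Proof. exact: adjoint_pairD. Qed.

Lemma saZ (r : R) A : selfadjoint ip A -> selfadjoint ip (r%:C *: A).
Proof. exact: adjoint_pairZ. Qed.

Lemma saN A : selfadjoint ip A -> selfadjoint ip (- A).
Proof. by move=> sA x y; rewrite !fctE ipNl ipNr sA. Qed.

Lemma saB A B : selfadjoint ip A -> selfadjoint ip B -> selfadjoint ip (A - B).
Proof. by move=> sA sB; apply: saD => //; exact: saN. Qed.

Lemma sa0 : selfadjoint ip 0.
Proof. by move=> x y; rewrite [LHS]ip0l [RHS]ip0r. Qed.

Lemma sa_id : selfadjoint ip idfun. Proof. by []. Qed.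

Lemma sa_scalar c : selfadjoint ip (scalar_op c).
Proof. exact/saZ/sa_id. Qed.

Lemma sa_iter n A : selfadjoint ip A -> selfadjoint ip (iter n A).
Proof. by move=> sA; elim: n => [//|n ih] x y; rewrite iterS sA ih iterSr. Qed.

Lemma sa_sum n (F : nat -> H -> H) :
  (forall i, selfadjoint ip (F i)) -> selfadjoint ip (\sum_(i < n) F i).
Proof.
move=> sF; elim: n => [|n ih]; first by rewrite big_ord0; exact: sa0.
by rewrite big_ord_recr/=; exact: (saD ih (sF n)).
Qed.

Lemma rip_sq A x : selfadjoint ip A -> rip ip (A (A x)) x = vnorm (A x) ^+ 2.
Proof. by move=> sA; rewrite sa_rip// ripxx. Qed.

Lemma positive_rip D x : positive_op ip D -> 0 <= rip ip (D x) x.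
Proof. by case=> _ /(_ x); rewrite lecE => /andP[]. Qed.

(** Polarization: the imaginary part of the form vanishes at [x], at [y] and at
    [x + 'i *: y]. *)
Lemma positive_selfadjoint D : positive_op ip D -> selfadjoint ip D.
Proof.
move=> [bD pD]; have lD := bounded_lin bD.
apply: (adjoint_of_rip lD) => x y; rewrite [RHS]ripC.
have im0 z : complex.Im (ip (D z) z) = 0 by apply: ger0_Im.
have := im0 (x + 'i%C *: y).
rewrite (linD lD) (linZ lD) ipDl !ipDr !ipZl !ipZr.
have -> : Num.conj 'i%C = - 'i%C :> R[i] by rewrite complexiE conjCi.
rewrite /rip; move: (im0 x) (im0 y).
case: (ip (D x) x) (ip (D x) y) (ip (D y) x) (ip (D y) y)
  => [a1 a2] [b1 b2] [c1 c2] [d1 d2] /= -> -> h.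
by move: h; simpc; lra.
Qed.

(** The operator inequality [U ^ 2 <= c U] for [0 <= U <= c]. *)
Lemma sa_nonneg_sq U x (c : R) : bounded_op U -> selfadjoint ip U ->
  (forall y, 0 <= rip ip (U y) y) -> 0 < c -> opnorm U <= c ->
  vnorm (U x) ^+ 2 <= c * rip ip (U x) x.
Proof.
move=> bU sU pU c0 Uc; have lU := bounded_lin bU.
(* the form is nonnegative at x - U x / c *)
have := pU (x - (c^-1)%:C *: U x).
rewrite (linB lU) (linZ lU) ripBl !ripBr !ripZl !ripZr (rip_sq _ sU) ripxx//.
have h : rip ip (U (U x)) (U x) <= c * vnorm (U x) ^+ 2.
  apply: (le_trans (ler_norm _)); apply: (le_trans (rip_le H_hilbert _ _)).
  by rewrite expr2 mulrA ler_wpM2r ?vnorm_ge0// vnorm_opnorm_le.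
move: (vnorm (U x) ^+ 2) (rip ip (U x) x) (rip ip (U (U x)) (U x)) h => n r s h.
have -> : r - c^-1 * n - (c^-1 * n - c^-1 * (c^-1 * s)) =
  c^-1 * (c^-1 * s - 2 * n + c * r) by field; rewrite gt_eqF.
rewrite pmulr_rge0 ?invr_gt0// => h2.
have h3 : c^-1 * s <= n by rewrite ler_pdivrMl.
lra.
Qed.

Lemma vnorm_shift_sq U x (c : R) : bounded_op U -> selfadjoint ip U ->
  (forall y, 0 <= rip ip (U y) y) -> 0 < c -> opnorm U <= c ->
  vnorm ((scalar_op c - U) x) ^+ 2 <= c ^+ 2 * vnorm x ^+ 2 - c * rip ip (U x) x.
Proof.
move=> bU sU pU c0 Uc; rewrite !fctE (vnorm_sqB H_hilbert) vnormZr ripZl.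
rewrite (ger0_norm (ltW c0)) exprMn (ripC _ x (U x)).
by have := sa_nonneg_sq x bU sU pU c0 Uc; lra.
Qed.

Lemma opnorm_le_sqrt U (m : R) : 0 <= m ->
  (forall x, vnorm (U x) ^+ 2 <= m * vnorm x ^+ 2) -> opnorm U <= Num.sqrt m.
Proof.
move=> m0 h; apply: opnorm_le => [|x]; first exact: sqrtr_ge0.
rewrite -(@ler_pXn2r _ 2)// ?nnegrE ?vnorm_ge0 ?mulr_ge0 ?sqrtr_ge0 ?vnorm_ge0//.
by rewrite exprMn sqr_sqrtr.
Qed.

Lemma opnorm_shift_positive D (c : R) : positive_op ip D -> 0 < c -> opnorm D <= c ->
  opnorm (scalar_op c - D) <= c.
Proof.
move=> pD c0 Dc; have [bD _] := pD.
rewrite -[leRHS](ger0_norm (ltW c0)) -sqrtr_sqr.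
apply: opnorm_le_sqrt => [|x]; first exact: sqr_ge0.
have pD' y := positive_rip y pD.
apply: (le_trans (vnorm_shift_sq x bD (positive_selfadjoint pD) pD' c0 Dc)).
by rewrite gerBl mulr_ge0 ?(ltW c0).
Qed.

(** For [c = ||U|| + e], [|(c - U) x|^2 <= (c^2 - c e) |x|^2], so that
    the Neumann series for [c - U] applies. *)
Lemma sa_coercive_invertible U (e : R) : bounded_op U -> selfadjoint ip U ->
  0 < e -> (forall x, e * vnorm x ^+ 2 <= rip ip (U x) x) -> op_invertible U.
Proof.
move=> bU sU e0 hU; pose c := opnorm U + e.
have c0 : 0 < c by rewrite ltr_wpDl// opnorm_ge0.
have Uc : opnorm U <= c by rewrite lerDl ltW.
have pU y : 0 <= rip ip (U y) y.
  by apply: le_trans (hU y); rewrite mulr_ge0 ?sqr_ge0 ?(ltW e0).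
have ec : 0 <= c ^+ 2 - c * e.
  by rewrite subr_ge0 expr2 ler_pM2l// lerDr opnorm_ge0.
apply: (@neumann_invertible _ _ _ H_hilbert _ c) => //.
apply: (@le_lt_trans _ _ (Num.sqrt (c ^+ 2 - c * e))).
  apply: opnorm_le_sqrt => // x.
  apply: (le_trans (vnorm_shift_sq x bU sU pU c0 Uc)).
  by have := hU x; rewrite -(ler_pM2l c0); lra.
rewrite -[ltRHS](ger0_norm (ltW c0)) -sqrtr_sqr ltr_sqrt ?exprn_gt0//.
by rewrite ltrBlDr ltrDl mulr_gt0.
Qed.

(** For [z = a + ib] the operators [A - z] and [A - conj z] commute, and their
    product [(A - a)^2 + b^2] is coercive. *)
Lemma sa_nonreal_invertible A (z : R[i]) : bounded_op A -> selfadjoint ip A ->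
  complex.Im z != 0 -> op_invertible (A - z *: idfun).
Proof.
move=> bA sA; case: z => a b /= b0; have lA := bounded_lin bA.
pose B := A - scalar_op a; pose U := B \o B + scalar_op (b ^+ 2).
have sB : selfadjoint ip B by apply: saB => //; exact: sa_scalar.
have bB : bounded_op B by apply: boundedB => //; exact: bounded_scalar.
have bU : bounded_op U.
  by apply: boundedD; [exact: bounded_comp|exact: bounded_scalar].
have bz (w : R[i]) : bounded_op (A - w *: idfun).
  by apply: boundedB => //; exact/boundedZ/bounded_id.
have iU : op_invertible U.
  apply: (@sa_coercive_invertible _ (b ^+ 2)) => //.
  - by apply: saD; [exact: adjoint_pair_comp|exact: sa_scalar].
  - by rewrite lt_def sqr_ge0 sqrf_eq0 b0.
  - move=> x; rewrite /U !fctE ripDl rip_sq// ripZl ripxx//.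
    by rewrite lerDr sqr_ge0.
have fac (w w' : R[i]) : w + w' = (2 * a)%:C -> w * w' = (a ^+ 2 + b ^+ 2)%:C ->
    (A - w *: idfun) \o (A - w' *: idfun) = U.
  move=> ws wp; apply/funext => x.
  rewrite /U /B /scalar_op !fctE !(linB lA) !(linZ lA) !scalerBr !scalerA.
  rewrite -rmorphM/= wp !opprB !addrA.
  transitivity (A (A x) - (2 * a)%:C *: A x + (a ^+ 2 + b ^+ 2)%:C *: x).
    by rewrite addrAC -(addrA (A (A x))) -opprD -scalerDl [w' + w]addrC ws.
  have -> : 2 * a = a + a by ring.
  rewrite !rmorphD/= !scalerDl opprD !addrA; congr (_ + _).
  by rewrite [RHS]addrAC expr2.
have e1 : a +i* b + (a -i* b) = (2 * a)%:C by simpc; congr (_ +i* _); ring.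
have e2 : (a +i* b) * (a -i* b) = (a ^+ 2 + b ^+ 2)%:C.
  by simpc; congr (_ +i* _); ring.
have e3 := e1; rewrite addrC in e3; have e4 := e2; rewrite mulrC in e4.
have f1 := fac _ _ e1 e2; have f2 := fac _ _ e3 e4.
apply: (@op_invertible_factor _ _ _ (A - (a -i* b) *: idfun)) => //.
  by rewrite f1 f2.
by rewrite f1.
Qed.

End SelfAdjoint.

(** * Polynomials in a self-adjoint operator *)

Section PolynomialCalculus.
Context {R : realType} {H : completeNormedModType R[i]}.
Variable ip : {dot H for (@Num.conj R[i])}.
Hypothesis H_hilbert : induces_norm ip.
Hypothesis H_nontrivial : exists v : H, v != 0.
Implicit Types (A B T : H -> H) (P Q : {poly R[i]}) (p q : {poly R}).

Definition cpolyop P A : H -> H := \sum_(i < size P) P`_i *: iter i A.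

Lemma cpolyop_wide n P A : (size P <= n)%N ->
  cpolyop P A = \sum_(i < n) P`_i *: iter i A.
Proof.
move=> Pn; rewrite /cpolyop (big_ord_widen n (fun i => P`_i *: iter i A) Pn).
rewrite big_mkcond; apply: eq_bigr => i _; case: ltnP => // Pi.
by rewrite nth_default// scale0r.
Qed.

Lemma cpolyopD P Q A : cpolyop (P + Q) A = cpolyop P A + cpolyop Q A.
Proof.
set n := maxn (size P) (size Q).
rewrite !(@cpolyop_wide n) ?leq_maxl ?leq_maxr ?size_polyD// -big_split/=.
by apply: eq_bigr => i _; rewrite coefD scalerDl.
Qed.

Lemma cpolyop0 A : cpolyop 0 A = 0.
Proof. by rewrite /cpolyop size_poly0 big_ord0. Qed.

Lemma cpolyopC a A : cpolyop a%:P A = a *: idfun.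
Proof.
by rewrite (@cpolyop_wide 1) ?size_polyC ?leq_b1// big_ord1 coefC.
Qed.

Lemma cpolyopZ a P A : cpolyop (a *: P) A = a *: cpolyop P A.
Proof.
rewrite (@cpolyop_wide (size P)) ?size_scale_leq// /cpolyop scaler_sumr.
by apply: eq_bigr => i _; rewrite coefZ scalerA.
Qed.

Lemma cpolyopMX P A : linear A -> cpolyop (P * 'X) A = A \o cpolyop P A.
Proof.
move=> lA; rewrite (@cpolyop_wide (size P).+1); last first.
  by apply: leq_trans (size_polyMleq _ _) _; rewrite size_polyX addn2.
rewrite big_ord_recl coefMX/= scale0r add0r; apply/funext => x.
rewrite /= /cpolyop (sum_ffunE _ (fun i => P`_i *: iter i A)).
rewrite (linS lA _ (fun i => (P`_i *: iter i A) x)).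
rewrite (sum_ffunE _ (fun i => (P * 'X)`_(bump 0 i) *: iter (bump 0 i) A)).
by apply: eq_bigr => i _; rewrite !fctE (linZ lA) coefMX.
Qed.

Lemma cpolyopM P Q A : linear A -> cpolyop (P * Q) A = cpolyop P A \o cpolyop Q A.
Proof.
move=> lA; elim/poly_ind: P => [|P c ih].
  by rewrite mul0r !cpolyop0.
rewrite mulrDl mul_polyC -mulrA [_ * Q]mulrC mulrA !cpolyopD cpolyopZ cpolyopC.
by rewrite !cpolyopMX// ih; apply/funext => x; rewrite !fctE.
Qed.

Lemma polyopE p A : polyop p A = cpolyop (map_poly (real_complex R) p) A.
Proof.
rewrite /polyop /cpolyop size_map_poly; apply: eq_bigr => i _.
by rewrite coef_map.
Qed.

Lemma polyopB p q A : polyop (p - q) A = polyop p A - polyop q A.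
Proof.
by rewrite !polyopE rmorphB/= -[- map_poly _ q]scaleN1r cpolyopD cpolyopZ scaleN1r.
Qed.

Lemma polyopC (r : R) A : polyop r%:P A = scalar_op r.
Proof. by rewrite polyopE map_polyC cpolyopC. Qed.

Lemma polyopX A : linear A -> polyop 'X A = A.
Proof.
move=> lA; rewrite polyopE map_polyX -['X]mul1r cpolyopMX// cpolyopC scale1r.
by apply/funext.
Qed.

Lemma bounded_polyop p A : bounded_op A -> bounded_op (polyop p A).
Proof.
move=> bA; rewrite /polyop; apply: (bounded_sum _ (F := fun i => (p`_i)%:C *: iter i A)).
by move=> i; apply/boundedZ/bounded_iter.
Qed.

Lemma sa_polyop p A : selfadjoint ip A -> selfadjoint ip (polyop p A).
Proof.
move=> sA; rewrite /polyop; apply: (sa_sum _ (F := fun i => (p`_i)%:C *: iter i A)).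
by move=> i; apply/saZ/sa_iter.
Qed.

(** Over the complex numbers [P] splits, so that [P(A)] is a product of factors
    [A - z] over the roots [z]. *)
Lemma cpolyop_root P A : linear A -> P != 0 -> ~ op_invertible (cpolyop P A) ->
  exists2 z, root P z & ~ op_invertible (A - z *: idfun).
Proof.
move=> lA P0; apply: contra_notP => h.
have [r Pr] := closed_field_poly_normal P; rewrite Pr cpolyopZ.
have -> : lead_coef P *: cpolyop (\prod_(z <- r) ('X - z%:P)) A =
    (lead_coef P *: idfun) \o cpolyop (\prod_(z <- r) ('X - z%:P)) A by [].
apply: op_invertible_comp; first by apply: op_invertible_scale; rewrite lead_coef_eq0.
have {h} : forall z, z \in r -> op_invertible (A - z *: idfun).
  move=> z zr; apply: contrapT => nz; apply: h; exists z => //.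
  by rewrite Pr rootZ ?lead_coef_eq0// root_prod_XsubC.
elim: r {Pr} => [|z r ih] h.
  by rewrite big_nil cpolyopC; apply: op_invertible_scale; rewrite oner_eq0.
rewrite big_cons cpolyopM//; apply: op_invertible_comp; last first.
  by apply: ih => w wr; apply: h; rewrite inE wr orbT.
rewrite -polyCN -['X]mul1r cpolyopD cpolyopMX// !cpolyopC.
have -> : A \o (1 *: idfun) + - z *: idfun = A - z *: idfun.
  by rewrite scale1r scaleNr.
by apply: h; rewrite inE eqxx.
Qed.

(** Vectors that almost attain the norm are approximate eigenvectors of the
    square: [|(B^2 - m^2) x|^2 <= m^2 (m^2 |x|^2 - |B x|^2)] for [m] the norm of
    [B]. An inverse [G] would bound [|B x|] away from [m]. *)
Lemma sa_square_not_invertible B : bounded_op B -> selfadjoint ip B ->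
  ~ op_invertible (B \o B - scalar_op (opnorm B ^+ 2)).
Proof.
move=> bB sB [G [bG _ GU]]; set m := opnorm B in GU.
have m0 : 0 <= m := opnorm_ge0 bB.
have key x : vnorm x ^+ 2 <= opnorm G ^+ 2 * (m ^+ 2 *
    (m ^+ 2 * vnorm x ^+ 2 - vnorm (B x) ^+ 2)).
  have {1}<- : G (B (B x) - (m ^+ 2)%:C *: x) = x.
    by have /(congr1 (fun g => g x))/= := GU.
  have hG := vnorm_opnorm (B (B x) - (m ^+ 2)%:C *: x) bG.
  apply: (@le_trans _ _ ((opnorm G * vnorm (B (B x) - (m ^+ 2)%:C *: x)) ^+ 2)).
    by rewrite ler_pXn2r// ?nnegrE ?mulr_ge0 ?vnorm_ge0 ?opnorm_ge0.
  rewrite exprMn; apply: ler_wpM2l; first exact: sqr_ge0.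
  rewrite (vnorm_sqB H_hilbert) ripZr (rip_sq H_hilbert _ sB) vnormZr.
  rewrite ger0_norm ?sqr_ge0//.
  have : vnorm (B (B x)) ^+ 2 <= m ^+ 2 * vnorm (B x) ^+ 2.
    rewrite -exprMn ler_pXn2r// ?nnegrE ?mulr_ge0 ?vnorm_ge0//.
    exact: vnorm_opnorm.
  by move: (vnorm (B x)) (vnorm (B (B x))) (vnorm x) => b bb v; lra.
have [v v0] := H_nontrivial.
have [mE|mn0] := eqVneq m 0.
  have := key v; rewrite mE expr0n/= !mul0r mulr0 leNgt.
  by rewrite exprn_gt0// vnorm_gt0.
have m2 : 0 < m ^+ 2 by rewrite exprn_gt0// lt_def mn0.
have g2 : 0 < opnorm G ^+ 2.
  rewrite lt_def sqr_ge0 andbT; apply/negP => /eqP g0.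
  by have := key v; rewrite g0 mul0r leNgt exprn_gt0// vnorm_gt0.
(* the gap by which an inverse [G] would lower the square of the norm *)
pose d := (opnorm G ^+ 2 * m ^+ 2)^-1.
have d0 : 0 < d by rewrite invr_gt0 mulr_gt0.
have hB x : vnorm (B x) ^+ 2 <= (m ^+ 2 - d) * vnorm x ^+ 2.
  have := key x; rewrite mulrA -(ler_pdivrMl _ _ (mulr_gt0 g2 m2)) -/d => h.
  by rewrite mulrBl lerBrDr -lerBrDl.
have md : 0 <= m ^+ 2 - d.
  have v2 : 0 < vnorm v ^+ 2 by rewrite exprn_gt0// vnorm_gt0.
  by rewrite -(pmulr_lge0 _ v2); apply: le_trans (hB v); exact: sqr_ge0.
have : m <= Num.sqrt (m ^+ 2 - d) by apply: opnorm_le_sqrt.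
rewrite -(@ler_pXn2r _ 2)// ?nnegrE ?sqrtr_ge0// sqr_sqrtr//.
by rewrite lerBrDr gerDl leNgt d0.
Qed.

(** Let [m] be the norm of [p(A)]. Then [p(A)^2 - m^2] is not invertible, and it is
    the product of the [A - z] over the complex roots [z] of [p^2 - m^2]. Some
    factor is not invertible; its [z] is real, and [p(z)^2 = m^2]. *)
Lemma polyop_opnorm p A : bounded_op A -> selfadjoint ip A ->
  exists2 l, real_spectrum A l & `|p.[l]| = opnorm (polyop p A).
Proof.
move=> bA sA; have lA := bounded_lin bA.
have main (r : {poly R}) : r ^+ 2 != (opnorm (polyop r A) ^+ 2)%:P ->
    exists2 l, real_spectrum A l & `|r.[l]| = opnorm (polyop r A).
  set m := opnorm _ => r0; pose P := map_poly (real_complex R) (r ^+ 2 - (m ^+ 2)%:P).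
  have P0 : P != 0 by rewrite map_poly_eq0 subr_eq0.
  have bp := bounded_polyop r bA.
  have PE : cpolyop P A = polyop r A \o polyop r A - scalar_op (m ^+ 2).
    rewrite /P rmorphB/= map_polyC/= rmorphXn/= expr2 -polyCN cpolyopD cpolyopC.
    by rewrite cpolyopM// -polyopE scaleNr.
  have ni : ~ op_invertible (cpolyop P A).
    by rewrite PE; apply: sa_square_not_invertible => //; exact: sa_polyop.
  have [z rz nz] := cpolyop_root lA P0 ni.
  have zr : z = (complex.Re z)%:C.
    have [z0|z0] := eqVneq (complex.Im z) 0; first by case: z z0 {rz nz} => a b /= ->.
    by case: nz; exact: sa_nonreal_invertible.
  exists (complex.Re z); first by rewrite /real_spectrum /= -zr.
  move: rz; rewrite zr /P rootE horner_map fmorph_eq0 !hornerE subr_eq0 => /eqP.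
  move/(congr1 Num.sqrt); rewrite !sqrtr_sqr [in RHS]ger0_norm ?opnorm_ge0//.
have [l0 hl0 _] : exists2 l, real_spectrum A l & True.
  have [|l hl _] := main 'X; last by exists l.
  apply/eqP => /(congr1 (fun r : {poly R} => size r)).
  by rewrite size_polyXn size_polyC; case: (_ != 0).
have [rE|] := eqVneq (p ^+ 2) (opnorm (polyop p A) ^+ 2)%:P; last exact: main.
exists l0 => //; have := congr1 (fun r => Num.sqrt r.[l0]) rE; rewrite !hornerE.
by rewrite !sqrtr_sqr [in RHS]ger0_norm ?opnorm_ge0//; exact: bounded_polyop.
Qed.

(** Two sequences of polynomials that approximate [f] on the spectrum differ by
    little there, hence in operator norm by [polyop_opnorm]. *)
Lemma fcalc_unique f A T : bounded_op A -> selfadjoint ip A -> is_fcalc f A T ->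
  fcalc f A = T.
Proof.
move=> bA sA fT; apply: (xget_unique 0 fT) => U [bU [q [qf qU]]].
have [bT [p [pf pT]]] := fT.
apply/eqP; rewrite -subr_eq0; apply/eqP/(opnorm_eq0 (boundedB bU bT)).
apply/eqP; rewrite eq_le opnorm_ge0 ?andbT; last exact: boundedB.
apply/ler_addgt0Pr => e e0; rewrite add0r.
have e4 : 0 < e / 4 by rewrite divr_gt0.
have /cvgrPdist_lt /(_ _ e4) hq := qU; have /cvgrPdist_lt /(_ _ e4) hp := pT.
have hF := @filterI _ \oo _ _ _ (filterI (pf _ e4) (qf _ e4)) (filterI hp hq).
have [n [[pn qn] []]] := @filter_ex _ \oo _ _ (hF _ _ _).
rewrite !sub0r !normrN => hpn hqn.
have bp := bounded_polyop (p n) bA; have bq := bounded_polyop (q n) bA.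
have -> : U - T = (polyop (p n) A - T) - (polyop (q n) A - U)
    + polyop (q n - p n) A.
  rewrite polyopB opprB; set a := polyop _ A; set b := polyop _ A.
  by rewrite addrA addrA subrK addrAC [a - T]addrC addrK addrC.
have [l hl lE] := polyop_opnorm (q n - p n) bA sA.
have hqp : opnorm (polyop (q n - p n) A) < e / 4 + e / 4.
  rewrite -lE !hornerE; have -> : (q n).[l] - (p n).[l] =
    ((q n).[l] - f l) - ((p n).[l] - f l) by ring.
  by apply: (le_lt_trans (ler_normB _ _)); apply: ltrD; [exact: qn|exact: pn].
have bpT := boundedB bp bT; have bqU := boundedB bq bU.
apply: (le_trans (opnormD (boundedB bpT bqU) (bounded_polyop _ bA))).
have h1 := opnormD bpT (boundedN bqU).
rewrite opnormN in h1.
move: (ler_norm (opnorm (polyop (p n) A - T))) (ler_norm (opnorm (polyop (q n) A - U))).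
move: h1 hqp hpn hqn; lra.
Qed.

(** By [polyop_opnorm] the norm of [c - D] is [|c - l|] for a point [l] of the
    spectrum, and [0 < l <= c] because [D] is positive and invertible. *)
Lemma opnorm_scalar_sub D (c : R) : positive_invertible ip D ->
    0 < c -> opnorm D <= c ->
  opnorm (scalar_op c - D) < c /\ opnorm (scalar_op c - D) <= c - spectral_min D.
Proof.
move=> [pD iD] c0 Dc; have [bD _] := pD.
have [l hl] := polyop_opnorm (c%:P - 'X) bD (positive_selfadjoint pD).
have -> : polyop (c%:P - 'X) D = scalar_op c - D.
  by rewrite polyopB polyopC polyopX//; exact: bounded_lin.
rewrite !hornerE => lE.
have lD : `|l| <= opnorm D := spectrum_bounded H_hilbert bD hl.
have lc : l <= c by apply: (le_trans (ler_norm l)); exact: le_trans Dc.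
rewrite ger0_norm ?subr_ge0// in lE.
have := opnorm_shift_positive H_hilbert pD c0 Dc; rewrite -lE => lc'.
have l0 : l != 0.
  by apply/eqP => l0; move: hl; rewrite /real_spectrum /spectrum/= l0 scale0r subr0.
split.
  by rewrite gtrBl lt_def l0; move: lc'; rewrite gerBl.
rewrite lerD2l lerN2; apply: ge_inf => //.
exists (- opnorm D) => k /(spectrum_bounded H_hilbert bD).
by rewrite ler_norml => /andP[].
Qed.

End PolynomialCalculus.

(** * Words in a fixed operator and perturbations *)

Section Words.
Context {R : realType} {H : completeNormedModType R[i]}.
Implicit Types (K L X Y Z : H -> H) (A B : nat -> H -> H) (s : seq (H -> H)).

(** If [A j] collects words of length [j], then [step K X A j] collects the words
    of length [j] obtained by putting some power of [K] and one letter [X] in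
    front, that is the sum of [K^i X A_k] over [i + k + 1 = j]. *)
Fixpoint step K X A (j : nat) : H -> H :=
  if j is j'.+1 then (K \o step K X A j') + (X \o A j') else 0.

(** The sum of all words of length [j] in which the letters of [s] occur once, in
    this order, and all other letters are [K]. A list of perturbations, rather
    than one operator, is needed for the multilinear form of the Taylor terms. *)
Fixpoint words K s : nat -> H -> H :=
  if s is X :: s' then step K X (words K s') else fun j => iter j K.

Lemma eq_step K X A B : A =1 B -> step K X A =1 step K X B.
Proof. by move=> AB; elim=> [//|j ih] /=; rewrite ih AB. Qed.

Lemma step_combl K X Y a A j : linear K ->
  step K (a *: X + Y) A j = a *: step K X A j + step K Y A j.
Proof.
move=> lK; elim: j => [|j ih] /=; first by rewrite scaler0 addr0.
rewrite ih; apply/funext => x.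
by rewrite !fctE (linD lK) (linZ lK) scalerDr addrACA.
Qed.

Lemma step_combr K X a A B j : linear K -> linear X ->
  step K X (fun j => a *: A j + B j) j = a *: step K X A j + step K X B j.
Proof.
move=> lK lX; elim: j => [|j ih] /=; first by rewrite scaler0 addr0.
rewrite ih; apply/funext => x.
by rewrite !fctE (linD lK) (linD lX) (linZ lK) (linZ lX) scalerDr addrACA.
Qed.

Lemma stepN K X j A : linear K -> step K (- X) A j = - step K X A j.
Proof.
move=> lK; elim: j => [|j ih] /=; first by rewrite oppr0.
by rewrite ih opprD; apply/funext => x; rewrite !fctE (linN lK).
Qed.

Lemma words_nseqN K X n j : linear K -> linear X ->
  words K (nseq n (- X)) j = (-1) ^+ n *: words K (nseq n X) j.
Proof.
move=> lK lX; elim: n j => [|n ih] j /=; first by rewrite scale1r.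
rewrite stepN// (eq_step _ _ ih); have := step_combr ((-1) ^+ n) (words K (nseq n X))
  (fun=> 0) j lK lX.
have -> : (fun j => (-1) ^+ n *: words K (nseq n X) j + 0) =
    (fun j => (-1) ^+ n *: words K (nseq n X) j).
  by apply/funext => i; rewrite addr0.
have step0 : step K X (fun=> 0) j = 0.
  elim: j => [//|j ihj] /=; rewrite ihj; apply/funext => x.
  by rewrite !fctE (lin0 lK) (lin0 lX) addr0.
by rewrite step0 addr0 exprS mulN1r scaleNr => ->.
Qed.

(** Expansion of [(K + Y)^j] by the number of factors [Y]. In the remainder, the
    letters behind the [N]-th factor [Y] are no longer expanded; this makes it an
    iterated [step], as are the words. *)
Lemma iter_expansion K Y N j : linear K -> linear Y ->
  iter j (K + Y) = \sum_(n < N) words K (nseq n Y) j +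
    iter N (step K Y) (fun i => iter i (K + Y)) j.
Proof.
move=> lK lY; elim: N j => [|N ih] j; first by rewrite big_ord0 add0r.
rewrite big_ord_recr/= -addrA; rewrite [LHS]ih; congr (_ + _).
elim: N {ih} j => [|N ih] j /=.
  elim: j => [|j ih]; first by rewrite addr0.
  apply/funext => x; have /(congr1 (fun g => g x)) := ih.
  by rewrite iterS !fctE => {1}->; rewrite (linD lK) addrA.
rewrite (eq_step _ _ ih); have := step_combr 1 (words K (nseq N Y))
  (step K Y (iter N (step K Y) (fun i => iter i (K + Y)))) j lK lY.
rewrite scale1r => <-; apply: eq_step => i; by rewrite scale1r.
Qed.

Lemma words_rcons0 K s X : words K (rcons s X) 0%N = 0.
Proof. by case: s. Qed.

(** The recursion of [words] read from the right end of the word; passing to the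
    adjoint exchanges it with the recursion from the left. *)
Lemma words_rconsS K s X j : linear K -> (forall Y, Y \in s -> linear Y) ->
  linear X ->
  words K (rcons s X) j.+1 =
  (words K (rcons s X) j \o K) + (words K s j \o X).
Proof.
move=> lK; elim: s j => [|Y s ih] j ls lX.
  elim: j => [|j ihj] /=.
    by apply/funext => x; rewrite !fctE (lin0 lK) !add0r.
  apply/funext => x; have ihx := congr1 (fun g => g x) ihj.
  rewrite -[LHS]/(K (words K [:: X] j.+1 x) + X (iter j.+1 K x)) ihx !fctE (linD lK).
  by rewrite [iter j.+1 K x]iterSr [iter j.+1 K (X x)]iterS addrAC.
have lY : linear Y by apply: ls; rewrite mem_head.
have {ls} ls Z : Z \in s -> linear Z by move=> Zs; apply: ls; rewrite inE Zs orbT.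
elim: j => [|j ihj].
  rewrite /= words_rcons0; apply/funext => x.
  by rewrite !fctE (lin0 lK) (lin0 lY).
apply/funext => x; have ihx := congr1 (fun g => g x) ihj.
rewrite -[LHS]/(K (words K (rcons (Y :: s) X) j.+1 x) +
  Y (words K (rcons s X) j.+1 x)) ihx (ih _ ls lX) !fctE (linD lK) (linD lY).
by rewrite addrACA.
Qed.

Section Bounds.
Variable ip : {dot H for (@Num.conj R[i])}.
Hypothesis H_hilbert : induces_norm ip.
Variable S : symNormedIdeal H.

(** Passing to the adjoint turns the first letter of a word into the last one:
    induction on the length, by the recursions from the left and from the right. *)
Lemma words_adjoint K s j : linear K -> selfadjoint ip K ->
  (forall Y, Y \in s -> ideal_sa ip S Y) ->
  adjoint_pair ip (words K s j) (words K (rev s) j).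
Proof.
move=> lK sK; elim: s j => [|X s ih] j hs; first exact: sa_iter.
have hX : ideal_sa ip S X by apply: hs; rewrite mem_head.
have {}hs Y : Y \in s -> ideal_sa ip S Y by move=> Ys; apply: hs; rewrite inE Ys orbT.
have li Y : ideal_sa ip S Y -> linear Y by case=> /ideal_bounded /bounded_lin.
rewrite rev_cons; elim: j => [|j ihj].
  by rewrite words_rcons0; exact: sa0.
rewrite words_rconsS//; first last.
- exact: li.
- by move=> Y; rewrite mem_rev => /hs/li.
by apply: adjoint_pairD; apply: adjoint_pair_comp => //; [exact: hX.2|exact: ih].
Qed.

(** A letter [K] has norm at most [a] but is charged with [b > a]. Since
    [a x / (b - a) + x = b x / (b - a)], the difference pays for all positions of
    the new letter [X]: no binomial coefficients appear. *)
Lemma step_bound K X A (a b mu : R) j : bounded_op K -> opnorm K <= a -> a < b ->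
  ideal_set S X -> (forall j, bounded_op (A j)) ->
  (forall j, opnorm (A j) <= mu * b ^+ j) ->
  ideal_set S (step K X A j) /\
  snorm S (step K X A j) <= snorm S X / (b - a) * mu * b ^+ j.
Proof.
move=> bK Ka ab iX bA nA.
have a0 : 0 <= a := le_trans (opnorm_ge0 bK) Ka.
have b0 : 0 < b := le_lt_trans a0 ab.
have x0 := snorm_ge0 iX; have d0 : 0 < b - a by rewrite subr_gt0.
have mu0 : 0 <= mu by have := le_trans (opnorm_ge0 (bA 0%N)) (nA 0%N); rewrite mulr1.
elim: j => [|j [ih1 ih2]].
  split; first exact: ideal0.
  by rewrite snorm0 !mulr_ge0// ?invr_ge0 ltW.
have i1 := ideal_comp bK ih1; have i2 := ideal_compr iX (bA j).
split; first exact: ideal_add.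
apply: (le_trans (snorm_triangle i1 i2)).
have h1 : snorm S (K \o step K X A j) <= a * (snorm S X / (b - a) * mu * b ^+ j).
  apply: (le_trans (snorm_comp bK ih1)).
  by apply: ler_pM => //; [exact: opnorm_ge0|exact: snorm_ge0].
have h2 : snorm S (X \o A j) <= snorm S X * (mu * b ^+ j).
  by apply: (le_trans (snorm_compr iX (bA j))); exact: ler_wpM2l.
apply: (le_trans (lerD h1 h2)); rewrite le_eqVlt; apply/orP; left; apply/eqP.
by rewrite exprS; field; rewrite gt_eqF.
Qed.

Lemma iter_bound L (b : R) j : bounded_op L -> opnorm L <= b ->
  opnorm (iter j L) <= 1 * b ^+ j.
Proof.
move=> bL Lb; rewrite mul1r; apply: (le_trans (opnorm_iter j bL)).
by apply: lerXn2r; rewrite ?nnegrE ?opnorm_ge0//; exact: (le_trans (opnorm_ge0 bL) Lb).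
Qed.

Lemma iter_step_bound K Y L (a b : R) N j : bounded_op K -> opnorm K <= a -> a < b ->
  ideal_set S Y -> bounded_op L -> opnorm L <= b ->
  ideal_set S (iter N.+1 (step K Y) (fun i => iter i L) j) /\
  snorm S (iter N.+1 (step K Y) (fun i => iter i L) j) <=
    (snorm S Y / (b - a)) ^+ N.+1 * b ^+ j.
Proof.
move=> bK Ka ab iY bL Lb; elim: N j => [|N ih] j.
  rewrite expr1 -[_ / _]mulr1; apply: step_bound => // i; first exact: bounded_iter.
  exact: iter_bound.
rewrite exprS iterS; apply: step_bound => // i; have [ii ni] := ih i.
  exact: (ideal_bounded ii).
exact: (le_trans (opnorm_le_snorm H_hilbert ii)).
Qed.

Lemma words_bound K s (a b : R) j : bounded_op K -> opnorm K <= a -> a < b ->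
  (forall Y, Y \in s -> ideal_set S Y) ->
  [/\ (0 < size s)%N -> ideal_set S (words K s j),
      bounded_op (words K s j),
      (0 < size s)%N ->
        snorm S (words K s j) <= (\prod_(Y <- s) (snorm S Y / (b - a))) * b ^+ j &
      opnorm (words K s j) <= (\prod_(Y <- s) (snorm S Y / (b - a))) * b ^+ j].
Proof.
move=> bK Ka ab; elim: s j => [|X s ih] j hs.
  split=> //=; first exact: bounded_iter.
  by rewrite big_nil; apply: iter_bound => //; exact: (le_trans Ka (ltW ab)).
have hX : ideal_set S X by apply: hs; rewrite mem_head.
have {}hs Y : Y \in s -> ideal_set S Y by move=> Ys; apply: hs; rewrite inE Ys orbT.
have [iw nw] : ideal_set S (words K (X :: s) j) /\
    snorm S (words K (X :: s) j) <= (\prod_(Y <- X :: s) (snorm S Y / (b - a))) * b ^+ j.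
  rewrite big_cons; apply: step_bound => // i; by have [] := ih i hs.
split=> //; first exact: (ideal_bounded iw).
exact: (le_trans (opnorm_le_snorm H_hilbert iw)).
Qed.

End Bounds.

(** Linearity in the letter with index [i]: exactly one letter of the word
    changes, since [e] has no repetitions. *)
Lemma words_map_comb (I : eqType) K (F : I -> H -> H) (e : seq I) i a Y Z j :
  linear K -> (forall k, linear (F k)) -> linear Y -> linear Z ->
  uniq e -> i \in e ->
  words K [seq [eta F with i |-> a *: Y + Z] k | k <- e] j =
  a *: words K [seq [eta F with i |-> Y] k | k <- e] j +
  words K [seq [eta F with i |-> Z] k | k <- e] j.
Proof.
move=> lK lF lY lZ; elim: e j => [//|k e ih] j /= /andP[ke ue].
have off (T : H -> H) : i \notin e ->
    [seq (if k0 == i then T else F k0) | k0 <- e] = [seq F k | k <- e].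
  move=> ie; apply/eq_in_map => k' k'e; case: eqP => // k'i.
  by rewrite -k'i k'e in ie.
rewrite inE; have [ik _|ik /= ie] := eqVneq i k.
  by subst k; rewrite /= !off// step_combl.
by rewrite (eq_step _ _ (fun j => ih j ue ie)) step_combr.
Qed.

End Words.

(** * The scalar power series of the integral representation *)

Section RealGeometricTails.
Context {R : realType}.
Implicit Types (u : nat -> R) (M q l : R).

Lemma sum_geo_tail u M q m n : 0 <= q < 1 -> (forall j, `|u j| <= M * q ^+ j) ->
  `|\sum_(j < m + n) u j - \sum_(j < m) u j| <= M * q ^+ m / (1 - q).
Proof.
move=> /andP[q0 q1] nu; have q1' : 0 < 1 - q by rewrite subr_gt0.
have M0 : 0 <= M by have := le_trans (normr_ge0 _) (nu 0%N); rewrite expr0 mulr1.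
suff : `|\sum_(j < m + n) u j - \sum_(j < m) u j| <=
    M * (q ^+ m - q ^+ (m + n)) / (1 - q).
  move=> /le_trans; apply; rewrite ler_wpM2r ?invr_ge0 ?(ltW q1')//.
  by rewrite ler_wpM2l// gerBl exprn_ge0.
elim: n => [|n ih]; first by rewrite addn0 !subrr mulr0 mul0r normr0.
rewrite addnS big_ord_recr/= addrAC; apply: (le_trans (ler_normD _ _)).
apply: (le_trans (lerD ih (nu _))); rewrite le_eqVlt; apply/orP; left; apply/eqP.
by rewrite exprS; field; rewrite gt_eqF.
Qed.

Lemma series_geo_tail u M q l J : 0 <= q < 1 -> (forall j, `|u j| <= M * q ^+ j) ->
  \sum_(j < n) u j @[n --> \oo] --> l ->
  `|\sum_(j < J) u j - l| <= M * q ^+ J / (1 - q).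
Proof.
move=> q01 nu cu.
have c1 : `|\sum_(j < J) u j - \sum_(j < n) u j| @[n --> \oo] --> `|\sum_(j < J) u j - l|.
  by apply: cvg_norm; apply: cvgB => //; exact: cvg_cst.
apply: (ler_cvg_to c1 (cvg_cst _)); exists J => // n /= Jn.
by rewrite distrC -(subnKC Jn); exact: sum_geo_tail.
Qed.

End RealGeometricTails.

Section Moments.
Context {R : realType}.
Variables (nu : {measure set R -> \bar R}) (c : R).
Hypothesis c0 : 0 < c.
Hypothesis nu_fin : (\int[nu]_(t in `]0%R, +oo[) ((t ^+ 2 + 1)^-1)%R%:E < +oo)%E.

Let E : set R := `]0, +oo[%classic.
Let s (t : R) : R := (t + c)^-1.

Lemma measurable_halfline : measurable E. Proof. exact: measurable_itv. Qed.
Let mE := measurable_halfline.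

Lemma halflineP t : E t <-> 0 < t.
Proof. by rewrite /E /= in_itv/= andbT. Qed.

Lemma measurable_halfline_cont (g : R -> R) :
  (forall t, 0 < t -> {for t, continuous g}) -> measurable_fun E g.
Proof.
move=> cg; apply: subspace_continuous_measurable_fun => //.
apply: continuous_in_subspaceT => t /set_mem/halflineP; exact: cg.
Qed.

Lemma measurable_shift_inv (l : R) : 0 < l -> measurable_fun E (fun t => (t + l)^-1).
Proof.
move=> l0; apply: measurable_halfline_cont => t t0.
apply: (@continuousV _ _ (fun t => t + l)); first by rewrite gt_eqF// addr_gt0.
by apply: cvgD; [exact: cvg_id|exact: cvg_cst].
Qed.

Lemma measurable_weight : measurable_fun E (fun t : R => (t ^+ 2 + 1)^-1).
Proof.
apply: measurable_halfline_cont => t t0.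
apply: (@cvgV R _ _ _ (fun t => t ^+ 2 + 1)); first by rewrite gt_eqF// ltr_wpDl ?sqr_ge0.
by apply: cvgD; [exact: exprn_continuous|exact: cvg_cst].
Qed.

Lemma integrable_weight : nu.-integrable E (fun t => ((t ^+ 2 + 1)^-1)%:E).
Proof.
apply/integrableP; split; first by apply/measurable_EFinP; exact: measurable_weight.
rewrite (eq_integral (fun t : R => ((t ^+ 2 + 1)^-1)%:E))// => t _.
by rewrite abse_EFin ger0_norm// invr_ge0 addr_ge0 ?sqr_ge0.
Qed.

Lemma weight_integrable (g : R -> R) (k : R) : measurable_fun E g ->
  (forall t, 0 < t -> `|g t| <= k * (t ^+ 2 + 1)^-1) ->
  nu.-integrable E (EFin \o g).
Proof.
move=> mg hg; apply: (le_integrable mE _ _ (integrableZl mE k integrable_weight)).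
  exact/measurable_EFinP.
move=> t /halflineP t0; rewrite /= lee_fin; apply: (le_trans (hg t t0)).
exact: ler_norm.
Qed.

Lemma shift_inv_gt0 t : 0 < t -> 0 < s t.
Proof. by move=> t0; rewrite invr_gt0 addr_gt0. Qed.

Lemma shift_inv_le t : 0 < t -> s t <= c^-1.
Proof. by move=> t0; rewrite lef_pV2 ?posrE ?addr_gt0// lerDr ltW. Qed.

Lemma shift_inv_exp_le t j : 0 < t -> s t ^+ j.+2 <= c^-1 ^+ j * s t ^+ 2.
Proof.
move=> t0; rewrite -addn2 exprD ler_wpM2r ?sqr_ge0//.
apply: lerXn2r; last exact: shift_inv_le.
  by rewrite nnegrE ltW// shift_inv_gt0.
by rewrite nnegrE invr_ge0 ltW.
Qed.

Lemma shift_inv_sq_le t : 0 < t -> s t ^+ 2 <= (1 + (c^-1) ^+ 2) * (t ^+ 2 + 1)^-1.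
Proof.
move=> t0; have t1 : 0 < t ^+ 2 + 1 :> R by rewrite ltr_wpDl ?sqr_ge0.
have tc : 0 < t + c by rewrite addr_gt0.
rewrite ler_pdivlMr// /s [(t + c)^-1 ^+ 2]exprVn ler_pdivrMl ?exprn_gt0// [leRHS]mulrC.
have -> : (1 + c^-1 ^+ 2) * (t + c) ^+ 2 =
  t ^+ 2 + 1 + (2 * t * c + c ^+ 2 + (c^-1) ^+ 2 * t ^+ 2 + c^-1 * 2 * t).
  by field; rewrite gt_eqF.
rewrite lerDl; have := invr_gt0 c; rewrite c0 => ci.
by rewrite !addr_ge0// ?mulr_ge0 ?sqr_ge0 ?(ltW t0) ?(ltW c0) ?(ltW ci).
Qed.

Lemma measurable_shift_inv_exp j : measurable_fun E (fun t => s t ^+ j).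
Proof. by apply: measurable_funX; exact: measurable_shift_inv. Qed.

Lemma integrable_shift_inv_exp j : nu.-integrable E (EFin \o (fun t => s t ^+ j.+2)).
Proof.
apply: (@weight_integrable _ (c^-1 ^+ j * (1 + (c^-1) ^+ 2))).
  exact: measurable_shift_inv_exp.
move=> t t0; rewrite ger0_norm ?exprn_ge0 ?(ltW (shift_inv_gt0 t0))//.
apply: (le_trans (shift_inv_exp_le j t0)); rewrite -mulrA ler_wpM2l ?shift_inv_sq_le//.
by rewrite exprn_ge0// invr_ge0 ltW.
Qed.

(** The exponents start at two: [(t + c)^-1] itself need not be integrable. *)
Definition moment (j : nat) : R := \int[nu]_(t in E) (s t ^+ j.+2).

Lemma moment_ge0 j : 0 <= moment j.
Proof.
by apply: Rintegral_ge0 => t /halflineP t0; rewrite exprn_ge0// ltW// shift_inv_gt0.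
Qed.

Lemma moment_le j : `|moment j| <= moment 0 * c^-1 ^+ j.
Proof.
rewrite ger0_norm ?moment_ge0// mulrC /moment -RintegralZl//; last exact: integrable_shift_inv_exp.
apply: le_Rintegral => //; first exact: integrable_shift_inv_exp.
  exact: (integrableZl mE (c^-1 ^+ j) (integrable_shift_inv_exp 0)).
by move=> t /halflineP; exact: shift_inv_exp_le.
Qed.

(** Dominated convergence: the partial sums are bounded by a constant multiple of
    [(t + c)^-2]. *)
Lemma integral_power_series (a : nat -> R) (A b : R) (g : R -> R) :
  0 <= b < c -> (forall j, `|a j| <= A * b ^+ j) ->
  (forall t : R, 0 < t -> \sum_(j < J) a j * s t ^+ j.+2 @[J --> \oo] --> g t) ->
  nu.-integrable E (EFin \o g) /\
  \sum_(j < J) a j * moment j @[J --> \oo] --> \int[nu]_(t in E) g t.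
Proof.
move=> /andP[b0 bc] ha hg.
have A0 : 0 <= A by have := le_trans (normr_ge0 _) (ha 0%N); rewrite expr0 mulr1.
have q01 : 0 <= b / c < 1 by rewrite divr_ge0 ?(ltW c0)//= ltr_pdivrMr// mul1r.
have q1 : 0 < 1 - b / c by rewrite subr_gt0; case/andP: q01.
pose F J (t : R) : R := \sum_(j < J) a j * s t ^+ j.+2.
have iF J : nu.-integrable E (EFin \o F J).
  have -> : EFin \o F J = (fun t => (\sum_(j < J) (a j * s t ^+ j.+2)%:E)%E).
    by apply/funext => t; rewrite /= -sumEFin.
  apply: integrable_sum => // j _.
  exact: (integrableZl mE (a j) (integrable_shift_inv_exp j)).
have mF J : measurable_fun E (F J).
  by apply/measurable_EFinP; have /integrableP[] := iF J.
have mg : measurable_fun E g.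
  by apply: (measurable_fun_cvg mF) => t /halflineP; exact: hg.
have dom J (t : R) : 0 < t -> `|F J t| <= A / (1 - b / c) * s t ^+ 2.
  move=> t0; have st0 := ltW (shift_inv_gt0 t0).
  have bnd j : `|a j * s t ^+ j.+2| <= A * s t ^+ 2 * (b / c) ^+ j.
    rewrite normrM (ger0_norm (exprn_ge0 _ st0)).
    apply: (le_trans (ler_pM (normr_ge0 _) (exprn_ge0 _ st0) (ha j) (shift_inv_exp_le j t0))).
    by rewrite expr_div_n exprVn; lra.
  have := sum_geo_tail 0 J q01 bnd; rewrite big_ord0 subr0 add0n expr0 mulr1.
  by rewrite mulrAC.
have emg : measurable_fun E (EFin \o g) by exact/measurable_EFinP.
have emF J : measurable_fun E (EFin \o F J) by exact/measurable_EFinP.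
have cF : \forall t \ae nu, E t -> (EFin \o F J) t @[J --> \oo] --> (EFin \o g) t.
  apply: aeW => t /halflineP t0; apply/fine_cvgP; split; first exact: nearW.
  exact: hg.
have dF : \forall t \ae nu, forall J, E t ->
    (`|(EFin \o F J) t| <= ((A / (1 - b / c))%:E * (s t ^+ 2)%:E))%E.
  by apply: aeW => t J /halflineP t0; rewrite /= lee_fin; exact: dom.
have [ig _ cI] := dominated_convergence mE emF emg cF
  (integrableZl mE _ (integrable_shift_inv_exp 0)) dF.
split=> //; have /fine_cvgP[_] : (\int[nu]_(t in E) (EFin \o F J) t)%E @[J --> \oo] -->
    (\int[nu]_(t in E) g t)%:E.
  by rewrite /Rintegral fineK//; exact: integrable_fin_num.
apply: cvg_trans; apply: near_eq_cvg; apply: nearW => J.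
rewrite -[LHS]/(\int[nu]_(t in E) F J t).
elim: J => [|J ih].
  rewrite big_ord0 /Rintegral (eq_integral (cst 0%E)) ?integral0// => t _.
  by rewrite /F big_ord0.
rewrite big_ord_recr/= -ih /moment -RintegralZl//; last exact: integrable_shift_inv_exp.
rewrite -RintegralD//; last exact: (integrableZl mE (a J) (integrable_shift_inv_exp J)).
by apply: eq_Rintegral => t _; rewrite /F big_ord_recr.
Qed.

End Moments.

Section LoewnerSeries.
Context {R : realType}.
Variables (f : R -> R) (alpha beta : R) (nu : {measure set R -> \bar R}) (c : R).
Hypothesis c0 : 0 < c.
Hypothesis f_loewner : loewner_representation f alpha beta nu.

Let E : set R := `]0, +oo[%classic.
Let nu_fin : (\int[nu]_(t in `]0%R, +oo[) ((t ^+ 2 + 1)^-1)%R%:E < +oo)%E.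
Proof. by case: f_loewner. Qed.

(** Minus the Taylor coefficients of [f] at [c] in powers of [c - l]; the linear
    part [beta * l] only affects the first one. *)
Definition loewner_coef (j : nat) : R :=
  moment nu c j + (if j == 0%N then beta else 0).

Lemma loewner_coef_le j :
  `|loewner_coef j| <= (moment nu c 0 + beta) * c^-1 ^+ j.
Proof.
have [b0 _ _] := f_loewner; have m0 : 0 <= moment nu c 0 := moment_ge0 nu c0 0.
rewrite /loewner_coef; case: j => [|j] /=.
  by rewrite expr0 mulr1 ger0_norm// addr_ge0.
rewrite addr0; apply: (le_trans (moment_le c0 nu_fin _)).
by rewrite ler_wpM2r ?exprn_ge0 ?invr_ge0 ?(ltW c0)// lerDl.
Qed.

Let mE : measurable E. Proof. exact: measurable_itv. Qed.

Let kernel (l t : R) : R := (t + l)^-1 - t / (t ^+ 2 + 1).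

(** The kernel equals [(1 - t l) / ((t + l) (t^2 + 1))], and
    [1 + t l <= (1 / l + l) (t + l)]. *)
Lemma integrable_kernel l : 0 < l -> nu.-integrable E (EFin \o kernel l).
Proof.
move=> l0; apply: (@weight_integrable _ _ nu_fin _ (l^-1 + l)).
  apply: measurable_funB; first exact: measurable_shift_inv.
  by apply: measurable_funM; [exact: measurable_id|exact: measurable_weight].
move=> t t0; have tl : 0 < t + l by rewrite addr_gt0.
have t1 : 0 < t ^+ 2 + 1 :> R by rewrite ltr_wpDl ?sqr_ge0.
have -> : kernel l t = (1 - t * l) / (t + l) * (t ^+ 2 + 1)^-1.
  by rewrite /kernel; field; rewrite !gt_eqF.
rewrite normrM [X in _ * X]ger0_norm ?invr_ge0 ?(ltW t1)//.
rewrite ler_wpM2r ?invr_ge0 ?(ltW t1)// normrM normfV (gtr0_norm tl).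
rewrite ler_pdivrMr//; apply: (@le_trans _ _ (1 + t * l)).
  by rewrite ler_norml; have := mulr_ge0 (ltW t0) (ltW l0); lra.
have -> : (l^-1 + l) * (t + l) = 1 + t * l + (l^-1 * t + l ^+ 2).
  by field; rewrite gt_eqF.
by rewrite lerDl addr_ge0 ?sqr_ge0// mulr_ge0 ?invr_ge0 ?(ltW l0) ?(ltW t0).
Qed.

Lemma loewner_Rintegral l : 0 < l ->
  f l = alpha + beta * l - \int[nu]_(t in E) kernel l t.
Proof.
move=> l0; have [_ _ /(_ l (ltW l0))] := f_loewner.
have ki := integrable_kernel l0.
rewrite -[X in (_ - X)%E]fineK ?integrable_fin_num//.
by rewrite -EFinB => -[].
Qed.

(** [1 / (t + l) - 1 / (t + c)] is a geometric series in [(c - l) / (t + c)], which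
    is integrated term by term. *)
Lemma loewner_series l : `|c - l| < c ->
  \sum_(j < J) loewner_coef j * (c - l) ^+ j.+1 @[J --> \oo] --> f c - f l.
Proof.
move=> lc; have l0 : 0 < l by move: lc; rewrite ltr_norml; lra.
have hg (t : R) : 0 < t ->
    \sum_(j < J) (c - l) ^+ j.+1 * (t + c)^-1 ^+ j.+2 @[J --> \oo] -->
    (t + l)^-1 - (t + c)^-1.
  move=> t0; have tc : 0 < t + c by rewrite addr_gt0.
  have tl : 0 < t + l by rewrite addr_gt0.
  set q := (c - l) / (t + c).
  have q1 : `|q| < 1.
    rewrite /q normrM normfV (gtr0_norm tc) ltr_pdivrMr// mul1r.
    by apply: (lt_trans lc); rewrite ltrDr.
  have := @cvg_geometric_series R ((c - l) * ((t + c)^-1) ^+ 2) q q1.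
  have -> : (c - l) * ((t + c)^-1) ^+ 2 / (1 - q) = (t + l)^-1 - (t + c)^-1.
    by rewrite /q; field; rewrite !gt_eqF// andbT/=; lra.
  apply: cvg_trans; apply: near_eq_cvg; apply: nearW => J.
  rewrite /series/= big_mkord; apply: eq_bigr => j _.
  by rewrite /geometric/= /q exprMn !exprS; ring.
have ha j : `|(c - l) ^+ j.+1| <= `|c - l| * `|c - l| ^+ j by rewrite normrX exprS.
have lc' : 0 <= `|c - l| < c by rewrite normr_ge0.
have [_ cI] := integral_power_series c0 nu_fin lc' ha hg.
have fE : f c - f l = beta * (c - l) + \int[nu]_(t in E) ((t + l)^-1 - (t + c)^-1).
  rewrite !loewner_Rintegral//.
  have -> : \int[nu]_(t in E) ((t + l)^-1 - (t + c)^-1) =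
      \int[nu]_(t in E) (kernel l t - kernel c t).
    by apply: eq_Rintegral => t _; rewrite /kernel; ring.
  rewrite RintegralB; first by ring.
  - exact: mE.
  - exact: integrable_kernel.
  - exact: integrable_kernel.
rewrite fE -cvg_shiftS/=.
have -> : (fun J => \sum_(j < J.+1) loewner_coef j * (c - l) ^+ j.+1) =
    (fun J => beta * (c - l) + \sum_(j < J.+1) (c - l) ^+ j.+1 * moment nu c j).
  apply/funext => J; rewrite !big_ord_recl/= /loewner_coef/= mulrDl expr1 addrA.
  congr (_ + _); first by ring.
  by apply: eq_bigr => j _; rewrite addr0 mulrC.
apply: cvgD; first exact: cvg_cst.
by rewrite (cvg_shiftS (fun J => \sum_(j < J) (c - l) ^+ j.+1 * moment nu c j)).
Qed.

Lemma loewner_series_tail l b J : 0 <= b < c -> `|c - l| <= b ->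
  `|\sum_(j < J) loewner_coef j * (c - l) ^+ j.+1 - (f c - f l)| <=
    (moment nu c 0 + beta) * b * (b / c) ^+ J / (1 - b / c).
Proof.
move=> /andP[b0 bc] lb.
apply: (@series_geo_tail _ (fun j => loewner_coef j * (c - l) ^+ j.+1)).
- by rewrite divr_ge0 ?(ltW c0)//= ltr_pdivrMr// mul1r.
- move=> j; rewrite normrM normrX.
  have h : `|c - l| ^+ j.+1 <= b ^+ j.+1 by apply: lerXn2r; rewrite ?nnegrE.
  apply: (le_trans (ler_pM (normr_ge0 _) (exprn_ge0 _ (normr_ge0 _)) (loewner_coef_le j) h)).
  by rewrite expr_div_n exprS exprVn; lra.
- by apply: loewner_series; exact: le_lt_trans lb bc.
Qed.

End LoewnerSeries.

(** * The functional calculus as a power series *)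

Section RealPolynomialCalculus.
Context {R : realType} {H : completeNormedModType R[i]}.
Implicit Types (A : H -> H) (p q : {poly R}).

Lemma polyopM p q A : linear A -> polyop (p * q) A = polyop p A \o polyop q A.
Proof. by move=> lA; rewrite !polyopE rmorphM/= cpolyopM. Qed.

Lemma polyopXn q A n : linear A -> polyop (q ^+ n) A = iter n (polyop q A).
Proof.
move=> lA; elim: n => [|n ih]; last by rewrite exprS polyopM// ih.
by rewrite expr0 -polyC1 polyopC /scalar_op scale1r.
Qed.

Lemma polyopZ (r : R) q A : polyop (r *: q) A = r%:C *: polyop q A.
Proof. by rewrite !polyopE map_polyZ cpolyopZ. Qed.

Lemma polyop_sum n (q : nat -> {poly R}) A :
  polyop (\sum_(j < n) q j) A = \sum_(j < n) polyop (q j) A.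
Proof.
elim: n => [|n ih].
  by rewrite !big_ord0 -[LHS]/(polyop 0%:P A) polyopC /scalar_op scale0r.
by rewrite !big_ord_recr/= -ih !polyopE rmorphD/= cpolyopD.
Qed.

End RealPolynomialCalculus.

Section WeightedSums.
Context {R : realType} {H : completeNormedModType R[i]}.
Variable ip : {dot H for (@Num.conj R[i])}.
Hypothesis H_hilbert : induces_norm ip.
Variables (a : nat -> R) (A c : R).
Hypothesis c0 : 0 < c.
Hypothesis a_le : forall j, `|a j| <= A * c^-1 ^+ j.
Implicit Types (W : nat -> H -> H).

(** The index is shifted because [a j] is the coefficient of the power [j + 1]. *)
Definition weighted_series W : H -> H := opsum (fun j => (a j)%:C *: W j.+1).

(** Sum of the geometric majorant [A / c^j * b^(j+1)]. *)
Definition weighted_series_bound (b : R) : R := A * b / (1 - b / c).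

Lemma weighted_series_ideal (S : symNormedIdeal H) W (b w : R) : 0 <= b < c ->
  (forall j, ideal_set S (W j)) -> (forall j, snorm S (W j) <= w * b ^+ j) ->
  [/\ ideal_set S (weighted_series W), sums_to (fun j => (a j)%:C *: W j.+1) (weighted_series W) &
      snorm S (weighted_series W) <= weighted_series_bound b * w].
Proof.
move=> /andP[b0 bc] iW nW.
have q01 : 0 <= b / c < 1 by rewrite divr_ge0 ?(ltW c0)//= ltr_pdivrMr// mul1r.
have iA j : ideal_set S ((a j)%:C *: W j.+1) by exact: idealZ.
have nA j : snorm S ((a j)%:C *: W j.+1) <= (A * b * w) * (b / c) ^+ j.
  rewrite snormZr//.
  apply: (le_trans (ler_pM (normr_ge0 _) (snorm_ge0 (iW _)) (a_le j) (nW _))).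
  by rewrite expr_div_n exprVn exprS; lra.
have [i1 s1 _] := geo_sums H_hilbert q01 iA nA; split=> //.
apply: (le_trans (snorm_opsum_le H_hilbert q01 iA nA)).
by rewrite le_eqVlt; apply/orP; left; apply/eqP; rewrite /weighted_series_bound; ring.
Qed.

Lemma weighted_series_op W (b w : R) : 0 <= b < c ->
  (forall j, bounded_op (W j)) -> (forall j, opnorm (W j) <= w * b ^+ j) ->
  sums_to (fun j => (a j)%:C *: W j.+1) (weighted_series W).
Proof. by move=> bc bW nW; have [] := weighted_series_ideal (S := bounded_ideal) bc bW nW. Qed.

End WeightedSums.

Section CalculusSeries.
Context {R : realType} {H : completeNormedModType R[i]}.
Variable ip : {dot H for (@Num.conj R[i])}.
Hypothesis H_hilbert : induces_norm ip.
Hypothesis H_nontrivial : exists v : H, v != 0.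
Variables (f : R -> R) (alpha beta : R) (nu : {measure set R -> \bar R}) (c : R).
Hypothesis c0 : 0 < c.
Hypothesis f_loewner : loewner_representation f alpha beta nu.
Implicit Types (D : H -> H).

Let coef := loewner_coef beta nu c.

Lemma spectrum_shift D l : bounded_op D -> real_spectrum D l ->
  `|c - l| <= opnorm (scalar_op c - D).
Proof.
move=> bD hl; apply: (spectrum_bounded H_hilbert).
  by apply: boundedB => //; exact: bounded_scalar.
move=> iU; apply: hl.
have -> : D - l%:C *: idfun = - (scalar_op c - D - (c - l)%:C *: idfun).
  by rewrite rmorphB/= scalerBl /scalar_op 2!opprB [RHS]addrC addrA subrK.
apply: op_invertibleN => //; apply/bounded_lin/boundedB.
  by apply: boundedB => //; exact: bounded_scalar.
exact: bounded_scalar.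
Qed.

(** The Taylor polynomials of [f] at [c] converge uniformly for
    [|c - l| <= ||c - D||], and the spectrum of [D] lies in that interval. *)
Lemma fcalc_series D : bounded_op D -> selfadjoint ip D ->
  opnorm (scalar_op c - D) < c ->
  fcalc f D = scalar_op (f c) - weighted_series coef (fun j => iter j (scalar_op c - D)).
Proof.
move=> bD sD Lc; set L := scalar_op c - D in Lc *.
have lD := bounded_lin bD.
have bL : bounded_op L by apply: boundedB => //; exact: bounded_scalar.
have L0 := opnorm_ge0 bL.
have bc : 0 <= opnorm L < c by rewrite L0.
have sF : sums_to (fun j => (coef j)%:C *: iter j.+1 L) (weighted_series coef (fun j => iter j L)).
  apply: (weighted_series_op H_hilbert c0 (loewner_coef_le c0 f_loewner) bc (w := 1)).
    by move=> j; exact: bounded_iter.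
  by move=> j; exact: iter_bound.
apply: (fcalc_unique H_hilbert H_nontrivial) => //.
have [_ bF cF] := sF; split; first by apply: boundedB => //; exact: bounded_scalar.
pose p J : {poly R} := (f c)%:P - \sum_(j < J) coef j *: (c%:P - 'X) ^+ j.+1.
have pE J : polyop (p J) D = scalar_op (f c) - \sum_(j < J) (coef j)%:C *: iter j.+1 L.
  rewrite polyopB polyopC (polyop_sum _ (fun j => coef j *: (c%:P - 'X) ^+ j.+1)).
  congr (_ - _); apply: eq_bigr => j _.
  by rewrite polyopZ polyopXn// polyopB polyopC polyopX.
exists p; split; last first.
  apply: cvg0_le cF => J; rewrite pE opprB addrC addrA subrK.
  rewrite opnorm_distC lexx andbT.
  exact: (opnorm_ge0 (sums_to_bounded_diff J sF)).
move=> e e0.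
have q01 : 0 <= opnorm L / c < 1.
  by rewrite divr_ge0 ?(ltW c0)//= ltr_pdivrMr// mul1r.
have := geo_to0 ((moment nu c 0 + beta) * opnorm L) q01.
move=> /cvgrPdist_lt /(_ e e0); apply: filterS => J; rewrite sub0r normrN => hJ l hl.
apply: (le_lt_trans _ (le_lt_trans (ler_norm _) hJ)).
apply: le_trans (loewner_series_tail c0 f_loewner J bc (spectrum_shift bD hl)).
rewrite -normrN le_eqVlt; apply/orP; left; apply/eqP; congr `|_|.
rewrite /p hornerE hornerN hornerC horner_sum.
rewrite (eq_bigr (fun j : 'I_J => coef j * (c - l) ^+ j.+1)); first by rewrite /coef; ring.
by move=> j _; rewrite !hornerE.
Qed.

End CalculusSeries.

(** * Taylor terms and remainder in the ideal *)

Section Expansion.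
Context {R : realType} {H : completeNormedModType R[i]}.
Variable ip : {dot H for (@Num.conj R[i])}.
Hypothesis H_hilbert : induces_norm ip.
Variable S : symNormedIdeal H.
Variables (a : nat -> R) (A c : R).
Hypothesis c0 : 0 < c.
Hypothesis a_le : forall j, `|a j| <= A * c^-1 ^+ j.
Variable K : H -> H.
Hypothesis K_bounded : bounded_op K.
Hypothesis K_sa : selfadjoint ip K.
Variable b : R.
Hypothesis Kb : opnorm K < b.
Hypothesis bc : b < c.
Implicit Types (X Y L : H -> H) (s : seq (H -> H)) (W : nat -> H -> H).

Let room := b - opnorm K.
Let b0c : 0 <= b < c.
Proof. by rewrite bc (le_trans (opnorm_ge0 K_bounded) (ltW Kb)). Qed.
Let kappa := weighted_series_bound A c b.
Let lK : linear K. Proof. exact: bounded_lin. Qed.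

Lemma sums_to_sum n (F : nat -> nat -> H -> H) (T : nat -> H -> H) :
  (forall i, sums_to (F i) (T i)) ->
  sums_to (fun j => \sum_(i < n) F i j) (\sum_(i < n) T i).
Proof.
move=> sF; elim: n => [|n ih].
  rewrite big_ord0; split; [|exact: bounded0|].
    by move=> j; rewrite big_ord0; exact: bounded0.
  rewrite (_ : (fun _ => _) = fun=> 0); first exact: cvg_cst.
  by apply/funext => J; rewrite big1 ?subrr ?opnorm0// => j _; rewrite big_ord0.
have := sums_toD ih (sF n); rewrite big_ord_recr/=; congr sums_to.
by apply/funext => j; rewrite big_ord_recr.
Qed.

Lemma weighted_series_adjoint W W' w w' : (forall j, bounded_op (W j)) ->
  (forall j, opnorm (W j) <= w * b ^+ j) -> (forall j, bounded_op (W' j)) ->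
  (forall j, opnorm (W' j) <= w' * b ^+ j) ->
  (forall j, adjoint_pair ip (W j) (W' j)) ->
  adjoint_pair ip (weighted_series a W) (weighted_series a W').
Proof.
move=> bW nW bW' nW' WW.
apply: (sums_to_adjoint H_hilbert (weighted_series_op H_hilbert c0 a_le b0c bW nW)
  (weighted_series_op H_hilbert c0 a_le b0c bW' nW')) => j.
exact: adjoint_pairZ.
Qed.

Lemma words_nseq_bound X n j : ideal_set S X -> (0 < n)%N ->
  ideal_set S (words K (nseq n X) j) /\
  snorm S (words K (nseq n X) j) <= (snorm S X / room) ^+ n * b ^+ j.
Proof.
move=> iX n0; have hs Y : Y \in nseq n X -> ideal_set S Y by move=> /nseqP[->].
have [iw _ nw _] := words_bound H_hilbert j K_bounded (lexx (opnorm K)) Kb hs.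
rewrite size_nseq in iw nw; split; first exact: iw.
apply: (le_trans (nw n0)); rewrite le_eqVlt; apply/orP; left; apply/eqP.
by congr (_ * _); rewrite big_nseq -/room; elim: n {hs iw nw n0} => [//|n ih] /=;
  rewrite ih exprS.
Qed.

(** The sign comes from [c - (C + X) = K - X] and from the minus sign in front of
    the series of [f]. *)
Definition poly_term n X : H -> H := (-1) ^+ n.+1 *: weighted_series a (words K (nseq n X)).

Lemma weighted_series_comb (z : R[i]) W1 W2 T1 T2 :
  sums_to (fun j => (a j)%:C *: W1 j.+1) T1 ->
  sums_to (fun j => (a j)%:C *: W2 j.+1) T2 ->
  weighted_series a (fun j => z *: W1 j + W2 j) = z *: T1 + T2.
Proof.
move=> s1 s2; apply: opsumE; have := sums_toD (sums_toZ z s1) s2.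
congr sums_to; apply/funext => j; by rewrite scalerDr !scalerA mulrC.
Qed.

Lemma poly_term_ideal n X : ideal_set S X -> (0 < n)%N ->
  [/\ ideal_set S (weighted_series a (words K (nseq n X))),
      sums_to (fun j => (a j)%:C *: words K (nseq n X) j.+1)
        (weighted_series a (words K (nseq n X))) &
      snorm S (weighted_series a (words K (nseq n X))) <= kappa * (snorm S X / room) ^+ n].
Proof.
move=> iX n0; apply: (weighted_series_ideal H_hilbert c0 a_le b0c) => j;
  by have [] := words_nseq_bound j iX n0.
Qed.

Lemma snorm_poly_term n X : ideal_set S X -> (0 < n)%N ->
  snorm S (poly_term n X) <= kappa * room^-1 ^+ n * snorm S X ^+ n.
Proof.
move=> iX n0; have [i1 _ n1] := poly_term_ideal iX n0.
rewrite /poly_term /= snormZ// normrX normrN1 expr1n /= mul1r.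
apply: (le_trans n1); rewrite expr_div_n exprVn.
by rewrite le_eqVlt; apply/orP; left; apply/eqP; ring.
Qed.

(** Summation of [iter_expansion] against the coefficients; words without a factor
    [Y] are the powers of [K]. *)
Lemma weighted_series_expansion Y N : ideal_set S Y -> opnorm (K + Y) <= b ->
  [/\ ideal_set S (weighted_series a (iter N.+1 (step K Y) (fun j => iter j (K + Y)))),
      snorm S (weighted_series a (iter N.+1 (step K Y) (fun j => iter j (K + Y)))) <=
        kappa * (snorm S Y / room) ^+ N.+1 &
      weighted_series a (fun j => iter j (K + Y)) - weighted_series a (fun j => iter j K) =
        \sum_(1 <= n < N.+1) weighted_series a (words K (nseq n Y)) +
        weighted_series a (iter N.+1 (step K Y) (fun j => iter j (K + Y)))].
Proof.
move=> iY Lb; have bY := ideal_bounded iY.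
have lY := bounded_lin bY.
have bL : bounded_op (K + Y) by exact: boundedD.
have hr j := iter_step_bound H_hilbert N j K_bounded (lexx _) Kb iY bL Lb.
have [ir sr nr] := weighted_series_ideal H_hilbert c0 a_le b0c
  (fun j => (hr j).1) (fun j => (hr j).2).
split=> //.
have sn n : sums_to (fun j => (a j)%:C *: words K (nseq n Y) j.+1)
    (weighted_series a (words K (nseq n Y))).
  case: n => [|n]; last by have [] := poly_term_ideal iY (ltn0Sn n).
  apply: (weighted_series_op H_hilbert c0 a_le b0c (w := 1)) => j; first exact: bounded_iter.
  exact/iter_bound/ltW.
have -> : weighted_series a (fun j => iter j (K + Y)) =
    \sum_(n < N.+1) weighted_series a (words K (nseq n Y)) +
    weighted_series a (iter N.+1 (step K Y) (fun j => iter j (K + Y))).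
  apply: opsumE; have := sums_toD (sums_to_sum N.+1 sn) sr.
  congr sums_to; apply/funext => j.
  by rewrite -scaler_sumr -scalerDr -iter_expansion.
rewrite big_ord_recl/= addrAC; congr (_ + _).
by rewrite addrC addKr big_add1/= big_mkord.
Qed.

Lemma poly_termN n X : linear X -> ideal_set S X ->
  weighted_series a (words K (nseq n.+1 (- X))) = - poly_term n.+1 X.
Proof.
move=> lX iX; have [_ s1 _] := poly_term_ideal iX (ltn0Sn n).
rewrite /poly_term [in RHS]exprS mulN1r scaleNr opprK.
apply: opsumE; have := sums_toZ ((-1) ^+ n.+1) s1; congr sums_to.
by apply/funext => j; rewrite words_nseqN// !scalerA mulrC.
Qed.

(** This is [weighted_series_expansion] at [Y = - X], with the signs absorbed into
    [poly_term]. *)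
Lemma taylor_remainder X N : ideal_sa ip S X -> opnorm (K - X) <= b ->
  let Z := weighted_series a (fun j => iter j K) - weighted_series a (fun j => iter j (K - X))
     - \sum_(1 <= n < N.+1) poly_term n X in
  ideal_set S Z /\ snorm S Z <= kappa * (snorm S X / room) ^+ N.+1.
Proof.
move=> [iX sX] Lb; have [i1 n1 E] := weighted_series_expansion N (idealN iX) Lb.
rewrite snormN// in n1.
set Z := _ - _; have -> : Z =
    - weighted_series a (iter N.+1 (step K (- X)) (fun j => iter j (K - X))).
  rewrite /Z -[X in X - \sum_(_ <= _ < _) _]opprB E opprD addrAC.
  rewrite -[RHS]add0r; congr (_ + _); apply/eqP; rewrite -opprD oppr_eq0.
  rewrite -big_split/= big_nat big1// => n /andP[n1' _].
  case: n n1' => // n _; rewrite poly_termN ?addNr//.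
  exact: (bounded_lin (ideal_bounded iX)).
by split; [exact: idealN|rewrite snormN].
Qed.

Lemma words_enum_bound n (F : 'I_n -> H -> H) (e : seq 'I_n) j :
  (forall i, ideal_sa ip S (F i)) -> (0 < n)%N -> perm_eq e (enum 'I_n) ->
  ideal_set S (words K [seq F i | i <- e] j) /\
  snorm S (words K [seq F i | i <- e] j) <=
    (\prod_(i < n) (snorm S (F i) / room)) * b ^+ j.
Proof.
move=> hF n0 pe.
have hs Y : Y \in [seq F i | i <- e] -> ideal_set S Y.
  by move=> /mapP[i _ ->]; exact: (hF i).1.
have [iw _ nw _] := words_bound H_hilbert j K_bounded (lexx (opnorm K)) Kb hs.
have se : (0 < size [seq F i | i <- e])%N.
  by rewrite size_map (perm_size pe) size_enum_ord.
split; first exact: iw.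
apply: (le_trans (nw se)); rewrite big_map (perm_big _ pe)/= big_enum/=.
by rewrite -/room.
Qed.

(** A word in distinct self-adjoint letters need not be self-adjoint; its mean with the
    reversed word is, and both agree when all letters are equal. *)
Definition symmetric_words n (F : 'I_n -> H -> H) (j : nat) : H -> H :=
  (2^-1 : R)%:C *: (words K [seq F i | i <- enum 'I_n] j +
                    words K [seq F i | i <- rev (enum 'I_n)] j).

Lemma symmetric_words_bound n (F : 'I_n -> H -> H) j :
  (forall i, ideal_sa ip S (F i)) -> (0 < n)%N ->
  [/\ ideal_set S (symmetric_words F j),
      snorm S (symmetric_words F j) <= (\prod_(i < n) (snorm S (F i) / room)) * b ^+ j &
      selfadjoint ip (symmetric_words F j)].
Proof.
move=> hF n0; have [i1 n1] := words_enum_bound j hF n0 (perm_refl _).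
have pr : perm_eq (rev (enum 'I_n)) (enum 'I_n) by rewrite perm_rev.
have [i2 n2] := words_enum_bound j hF n0 pr.
have i12 := ideal_add i1 i2; split; first exact: idealZ.
  rewrite snormZr// ger0_norm ?invr_ge0//.
  have := le_trans (snorm_triangle i1 i2) (lerD n1 n2); lra.
apply: saZ.
have hs e Y : Y \in [seq F i | i <- e] -> ideal_sa ip S Y by move=> /mapP[i _ ->].
rewrite map_rev; set s := [seq _ | _ <- _].
have ad := words_adjoint j lK K_sa (hs (enum 'I_n)); rewrite -/s in ad.
move=> x y; rewrite !fctE ipDl ipDr ad addrC; congr (_ + _).
by rewrite ipC -ad -ipC.
Qed.

Lemma symmetric_words_diag n X j : symmetric_words (fun _ : 'I_n => X) j =
  words K (nseq n X) j.
Proof.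
have E (e : seq 'I_n) : [seq X | _ <- e] = nseq (size e) X by elim: e => //= _ e ->.
rewrite /symmetric_words !E size_rev size_enum_ord; set w := words _ _ _.
have h : (2^-1 : R)%:C * (1 + 1) = 1 :> R[i].
  by rewrite -(rmorph1 (real_complex R)) -rmorphD -rmorphM/=; congr (_%:C); field.
by rewrite -{1 2}(scale1r w) -scalerDl scalerA h scale1r.
Qed.

Lemma symmetric_words_comb n (F : 'I_n -> H -> H) i (r : R) Y Z j :
  (forall k, linear (F k)) -> linear Y -> linear Z ->
  symmetric_words [eta F with i |-> r%:C *: Y + Z] j =
  r%:C *: symmetric_words [eta F with i |-> Y] j + symmetric_words [eta F with i |-> Z] j.
Proof.
move=> lF lY lZ; rewrite /symmetric_words.
have ue : uniq (enum 'I_n) by exact: enum_uniq.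
have ie : i \in enum 'I_n by rewrite mem_enum.
rewrite !words_map_comb ?rev_uniq ?mem_rev// scalerA [r%:C * _]mulrC -scalerA -scalerDr.
congr (_ *: _); by rewrite addrACA [in RHS]scalerDr.
Qed.

(** The multilinear form is the series of the symmetrized words, which takes
    self-adjoint values also at tuples of distinct arguments. *)
Lemma homogeneous_poly_term n : (0 < n)%N ->
  homogeneous_polynomial ip S n (poly_term n).
Proof.
move=> n0; exists (fun F => (-1) ^+ n.+1 *: weighted_series a (symmetric_words F)); last first.
  move=> X _; rewrite /poly_term; congr (_ *: weighted_series a _).
  by apply/funext => j; rewrite symmetric_words_diag.
have wi (F : 'I_n -> H -> H) : (forall i, ideal_sa ip S (F i)) ->
    [/\ ideal_set S (weighted_series a (symmetric_words F)),
        sums_to (fun j => (a j)%:C *: symmetric_words F j.+1)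
          (weighted_series a (symmetric_words F)) &
        snorm S (weighted_series a (symmetric_words F)) <=
          kappa * \prod_(i < n) (snorm S (F i) / room)].
  by move=> hF; apply: (weighted_series_ideal H_hilbert c0 a_le b0c) => j;
    have [] := symmetric_words_bound j hF n0.
have upd (F : 'I_n -> H -> H) i Y : (forall j, ideal_sa ip S (F j)) ->
    ideal_sa ip S Y -> forall j, ideal_sa ip S ([eta F with i |-> Y] j).
  by move=> hF hY j /=; case: eqP.
have signE : (-1) ^+ n.+1 = ((-1) ^+ n.+1)%:C :> R[i] by rewrite rmorphXn rmorphN1.
split.
- move=> F hF; have [i1 _ _] := wi F hF; split; first exact: idealZ.
  rewrite signE; apply: saZ.
  have h j := symmetric_words_bound j hF n0.
  have bw j : bounded_op (symmetric_words F j).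
    by have [iw _ _] := h j; exact: (ideal_bounded iw).
  have nw j : opnorm (symmetric_words F j) <=
      (\prod_(i < n) (snorm S (F i) / room)) * b ^+ j.
    by have [iw nw _] := h j; exact: (le_trans (opnorm_le_snorm H_hilbert iw)).
  by apply: (weighted_series_adjoint bw nw bw nw) => j; have [] := h j.
- move=> F i r Y Z hF hY hZ.
  have li T : ideal_sa ip S T -> linear T by case=> /ideal_bounded /bounded_lin.
  have [_ s1 _] := wi _ (upd F i Y hF hY); have [_ s2 _] := wi _ (upd F i Z hF hZ).
  rewrite !scalerA [r%:C * _]mulrC -scalerA -scalerDr; congr (_ *: _).
  rewrite -(weighted_series_comb r%:C s1 s2); congr (weighted_series a _); apply/funext => j.
  by apply: symmetric_words_comb => [k||]; exact: li.
- exists (kappa * room^-1 ^+ n) => F hF; have [i1 _ n1] := wi F hF.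
  rewrite snormZ// normrX normrN1 expr1n /= mul1r; apply: (le_trans n1).
  by rewrite big_split/= prodr_const card_ord; lra.
Qed.

End Expansion.

(** * Taylor terms as weak integrals *)

Section TaylorIntegrals.
Context {R : realType} {H : completeNormedModType R[i]}.
Variable ip : {dot H for (@Num.conj R[i])}.
Hypothesis H_hilbert : induces_norm ip.
Variable S : symNormedIdeal H.
Variables (nu : {measure set R -> \bar R}) (c : R).
Hypothesis c0 : 0 < c.
Hypothesis nu_fin : (\int[nu]_(t in `]0%R, +oo[) ((t ^+ 2 + 1)^-1)%R%:E < +oo)%E.
Variable C : H -> H.
Hypothesis C_bounded : bounded_op C.
Let K := scalar_op c - C.
Variable b : R.
Hypothesis Kb : opnorm K < b.
Hypothesis bc : b < c.
Variable X : H -> H.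
Hypothesis X_ideal : ideal_set S X.

Let K_bounded : bounded_op K.
Proof. by apply: boundedB => //; exact: bounded_scalar. Qed.
Let b0c : 0 <= b < c.
Proof. by rewrite bc (le_trans (opnorm_ge0 K_bounded) (ltW Kb)). Qed.
Let X_bounded : bounded_op X. Proof. exact: ideal_bounded X_ideal. Qed.

Let letters n Y : Y \in nseq n X -> ideal_set S Y.
Proof. by move=> /nseqP[->]. Qed.

Let wb n : R := \prod_(Y <- nseq n X) (snorm S Y / (b - opnorm K)).

Lemma words_nseq_op n j : bounded_op (words K (nseq n X) j) /\
  opnorm (words K (nseq n X) j) <= wb n * b ^+ j.
Proof.
by have [_ bw _ nw] := words_bound H_hilbert j K_bounded (lexx _) Kb (@letters n).
Qed.

(** The resolvent [G] at [t] inverts [(t + c) - K]. Let [T] be the generating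
    series of a family and [U] that of the family that [step K X] produces. The
    recursion of [step] gives [((t + c) - K) U = X T], hence [U = G X T]. *)
Lemma integrand_series n t : 0 < t ->
  sums_to (fun j => ((t + c)^-1 ^+ j.+1)%:C *: words K (nseq n X) j)
    (taylor_integrand C n X t).
Proof.
move=> t0; have tc : 0 < t + c by rewrite addr_gt0.
have Ktc : opnorm K < t + c.
  by apply: (lt_trans Kb); apply: (lt_trans bc); rewrite ltrDr.
have [G iG sG] := neumann H_hilbert K_bounded Ktc.
have GE : resolvent C t = G.
  apply: opinvE; suff <- : scalar_op (t + c) - K = t%:C *: idfun + C by [].
  by rewrite /K opprB /scalar_op rmorphD/= scalerDl -addrA; congr (_ + _); rewrite addrC subrK.
elim: n => [|n ih].
  by rewrite /taylor_integrand /= GE.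
have -> : taylor_integrand C n.+1 X t = G \o X \o taylor_integrand C n X t.
  by rewrite /taylor_integrand GE.
set T := taylor_integrand C n X t in ih *.
have q01 : 0 <= b / (t + c) < 1.
  rewrite divr_ge0 ?(ltW tc)//=; last by case/andP: b0c.
  by rewrite ltr_pdivrMr// mul1r (lt_trans bc)// ltrDr.
pose A j := ((t + c)^-1 ^+ j.+1)%:C *: words K (nseq n.+1 X) j.
have bA j : bounded_op (A j) by apply: boundedZ; exact: (words_nseq_op n.+1 j).1.
have nA j : opnorm (A j) <= ((t + c)^-1 * wb n.+1) * (b / (t + c)) ^+ j.
  have [bw nw] := words_nseq_op n.+1 j.
  rewrite /A opnormZ// Re_normc_real ger0_norm ?exprn_ge0 ?invr_ge0 ?(ltW tc)//.
  apply: (le_trans (ler_wpM2l _ nw)); first by rewrite exprn_ge0// invr_ge0 ltW.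
  by rewrite expr_div_n exprS !exprVn; lra.
have [bU sU _] := geo_sums H_hilbert (S := bounded_ideal) q01 bA nA.
set U := opsum A in bU sU.
have A0 : A 0%N = 0 by rewrite /A /= scaler0.
have sK := sums_to_comp K_bounded sU.
have stc := sums_toZ (t + c)%:C (sums_to_shift0 A0 sU).
have sX := sums_to_comp X_bounded ih.
have E : (t + c)%:C *: U - (K \o U) = X \o T.
  apply: (sums_to_unique _ sX).
  have := sums_toD stc (sums_toN sK); congr sums_to; apply/funext => j.
  apply/funext => x; rewrite /A !fctE (linZ (bounded_lin K_bounded)) !scalerA -rmorphM.
  rewrite [_ ^+ j.+2]exprS mulrA mulfV ?gt_eqF// mul1r.
  rewrite (linZ (bounded_lin X_bounded)) -scalerBr; congr (_ *: _).
  by rewrite -[words K _ j.+1 x]/(K (words K (nseq n.+1 X) j x) +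
    X (words K (nseq n X) j x)) addrAC subrr add0r.
suff -> : G \o X \o T = U by [].
apply/funext => x; rewrite -[LHS]/(G (X (T x))).
have /(congr1 (fun g => g x))/= <- := E.
by have [_ _ /(congr1 (fun g => g (U x)))] := iG.
Qed.

(** The candidate for the weak integral: each power of [(t + c)^-1] in the
    generating series is replaced by its integral. *)
Definition taylor_moment n : H -> H := weighted_series (moment nu c) (words K (nseq n X)).

Lemma taylor_moment_sums n :
  sums_to (fun j => (moment nu c j)%:C *: words K (nseq n X) j.+1) (taylor_moment n).
Proof.
by apply: (weighted_series_op H_hilbert c0 (moment_le c0 nu_fin) b0c (w := wb n)) => j;
  have [] := words_nseq_op n j.
Qed.

Lemma taylor_scalar_integral n x y (g : R -> R) : (0 < n)%N ->
  (forall t, 0 < t -> g t = rip ip (taylor_integrand C n X t x) y) ->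
  nu.-integrable `]0%R, +oo[ (EFin \o g) /\
  \int[nu]_(t in `]0%R, +oo[) g t = rip ip (taylor_moment n x) y.
Proof.
move=> n0 gE; have w0 : words K (nseq n X) 0%N = 0 by case: n n0 {gE}.
pose a j := rip ip (words K (nseq n X) j.+1 x) y.
have ha j : `|a j| <= (wb n * b * vnorm x * vnorm y) * b ^+ j.
  have [bw nw] := words_nseq_op n j.+1.
  apply: (le_trans (rip_le H_hilbert _ _)).
  have := ler_wpM2r (vnorm_ge0 y) (vnorm_opnorm_le x bw nw); rewrite exprS; lra.
have hg (t : R) : 0 < t ->
    \sum_(j < J) a j * (t + c)^-1 ^+ j.+2 @[J --> \oo] --> g t.
  move=> t0; rewrite gE//.
  have s1 : sums_to (fun j => ((t + c)^-1 ^+ j.+2)%:C *: words K (nseq n X) j.+1)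
      (taylor_integrand C n X t).
    apply: (sums_to_shift0 (A := fun j => ((t + c)^-1 ^+ j.+1)%:C *: words K _ j)).
      by rewrite w0 scaler0.
    exact: integrand_series.
  have := @sums_to_rip _ _ _ H_hilbert _ _ x y s1; apply: cvg_trans; apply: near_eq_cvg.
  by apply: nearW => J; apply: eq_bigr => j _; rewrite /a !fctE ripZl mulrC.
have [ig cI] := integral_power_series c0 nu_fin b0c ha hg; split=> //.
have c2 := @sums_to_rip _ _ _ H_hilbert _ _ x y (taylor_moment_sums n).
suff c3 : \sum_(j < J) a j * moment nu c j @[J --> \oo] --> rip ip (taylor_moment n x) y.
  by apply: cvg_unique cI c3.
move: c2; apply: cvg_trans; apply: near_eq_cvg.
by apply: nearW => J; apply: eq_bigr => j _; rewrite /a !fctE ripZl mulrC.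
Qed.

(** The imaginary part at [x] is the real part at [- 'i *: x]. *)
Lemma taylor_weak_integral n : (0 < n)%N ->
  is_weak_integral ip nu `]0, +oo[ (taylor_integrand C n X) (taylor_moment n).
Proof.
move=> n0; have [_ bT _] := taylor_moment_sums n; split=> // x y.
have hRe t : 0 < t -> complex.Re (ip (taylor_integrand C n X t x) y) =
  rip ip (taylor_integrand C n X t x) y by [].
have hIm t : 0 < t -> complex.Im (ip (taylor_integrand C n X t x) y) =
    rip ip (taylor_integrand C n X t (- 'i *: x)) y.
  move=> t0; have [_ bI _] := integrand_series n t0.
  by rewrite Im_ip (linZ (bounded_lin bI)).
have [i1 e1] := taylor_scalar_integral n0 hRe.
have [i2 e2] := taylor_scalar_integral n0 hIm.
by split=> //; rewrite e1 e2 (linZ (bounded_lin bT)) -ip_rip.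
Qed.

Lemma weak_integral_unique E h T U : is_weak_integral ip nu E h T ->
  is_weak_integral ip nu E h U -> T = U.
Proof.
move=> [_ hT] [_ hU]; apply/funext => x; apply/eqP; rewrite -subr_eq0; apply/eqP.
apply: (ip_ext H_hilbert) => y; rewrite ripBl /rip.
by have [_ _ ->] := hT x y; have [_ _ ->] := hU x y; rewrite subrr.
Qed.

Lemma taylor_integralE n : (0 < n)%N ->
  taylor_integral ip nu C n X = taylor_moment n.
Proof.
move=> n0; apply: (xget_unique 0 (taylor_weak_integral n0)) => U hU.
exact: weak_integral_unique (taylor_weak_integral n0).
Qed.

Lemma sums_to_single (T : H -> H) : bounded_op T ->
  sums_to (fun j => if j == 0%N then T else 0) T.
Proof.
move=> bT; split=> // [j|]; first by case: eqP => // _; exact: bounded0.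
rewrite -cvg_shiftS/= (_ : (fun _ => _) = fun=> 0); first exact: cvg_cst.
by apply/funext => J; rewrite big_ord_recl/= big1 ?addr0 ?subrr ?opnorm0.
Qed.

(** The linear part [beta * l] of the representation contributes to the first
    coefficient of the series only, and the words of length one with [n] factors
    [X] vanish unless [n = 1]. *)
Lemma taylor_termE beta n : (0 < n)%N ->
  taylor_term ip beta nu C n X = poly_term (loewner_coef beta nu c) K n X.
Proof.
move=> n0; rewrite /taylor_term !taylor_integralE// /poly_term.
have w1 : words K (nseq n X) 1%N = if n == 1%N then X else 0.
  case: n n0 => // n _; rewrite [LHS]/=.
  have -> : K \o (0 : H -> H) = 0.
    by apply/funext => x /=; exact: (lin0 (bounded_lin K_bounded)).
  rewrite add0r; case: n => [|n] /=; first by apply/funext.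
  by apply/funext => x /=; exact: (lin0 (bounded_lin X_bounded)).
have -> : weighted_series (loewner_coef beta nu c) (words K (nseq n X)) =
    taylor_moment n + beta%:C *: words K (nseq n X) 1%N.
  have [bw _] := words_nseq_op n 1.
  apply: opsumE; have := sums_toD (taylor_moment_sums n)
    (sums_to_single (boundedZ beta%:C bw)).
  congr sums_to; apply/funext => j; rewrite /loewner_coef rmorphD/= scalerDl.
  by congr (_ + _); case: j => [//|j] /=; rewrite scale0r.
rewrite w1; have [->|n1] := eqVneq n 1%N; last first.
  by rewrite scaler0 addr0.
by rewrite sqrrN expr1n scale1r addrC.
Qed.

End TaylorIntegrals.

(** * Expansion of the functional calculus *)

Section Analyticity.
Context {R : realType} {H : completeNormedModType R[i]}.
Variable ip : {dot H for (@Num.conj R[i])}.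
Hypothesis H_hilbert : induces_norm ip.
Hypothesis H_nontrivial : exists v : H, v != 0.
Variable S : symNormedIdeal H.
Variables (f : R -> R) (alpha beta : R) (nu : {measure set R -> \bar R}).
Hypothesis f_loewner : loewner_representation f alpha beta nu.
Implicit Types (C D X : H -> H).

Section Center.
Variables (c : R) (C : H -> H).
Hypothesis c0 : 0 < c.
Hypothesis C_bounded : bounded_op C.
Hypothesis C_sa : selfadjoint ip C.
Variable b : R.
Let K := scalar_op c - C.
Hypothesis Kb : opnorm K < b.
Hypothesis bc : b < c.
Let coef := loewner_coef beta nu c.
Let kappa := weighted_series_bound (moment nu c 0 + beta) c b.

Let K_bounded : bounded_op K.
Proof. by apply: boundedB => //; exact: bounded_scalar. Qed.
Let K_sa : selfadjoint ip K. Proof. by apply: saB => //; exact: sa_scalar. Qed.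
Let a_le := loewner_coef_le c0 f_loewner.

Lemma fcalc_remainder X N : ideal_sa ip S X -> opnorm (K - X) <= b ->
  let Z := fcalc f (C + X) - fcalc f C - \sum_(1 <= n < N.+1) poly_term coef K n X in
  ideal_set S Z /\
  snorm S Z <= kappa * (snorm S X / (b - opnorm K)) ^+ N.+1.
Proof.
move=> hX Lb; have [iX sX] := hX; have bX := ideal_bounded iX.
have LE : scalar_op c - (C + X) = K - X by rewrite /K opprD addrA.
have Lc : opnorm (K - X) < c := le_lt_trans Lb bc.
have Kc : opnorm K < c := lt_trans Kb bc.
have fD : fcalc f (C + X) = scalar_op (f c) - weighted_series coef (fun j => iter j (K - X)).
  rewrite (fcalc_series H_hilbert H_nontrivial c0 f_loewner) ?LE//.
    exact: boundedD.
  exact: saD.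
have fC : fcalc f C = scalar_op (f c) - weighted_series coef (fun j => iter j K).
  exact: (fcalc_series H_hilbert H_nontrivial c0 f_loewner).
have := taylor_remainder H_hilbert c0 a_le K_bounded Kb bc N hX Lb.
suff -> : fcalc f (C + X) - fcalc f C =
    weighted_series coef (fun j => iter j K) - weighted_series coef (fun j => iter j (K - X)) by [].
by rewrite fD fC opprB [LHS]addrC addrA subrK.
Qed.

Lemma fcalc_sa D : bounded_op D -> selfadjoint ip D ->
  opnorm (scalar_op c - D) < c -> selfadjoint ip (fcalc f D).
Proof.
move=> bD sD Dc; rewrite (fcalc_series H_hilbert H_nontrivial c0 f_loewner)//.
apply: saB; first exact: sa_scalar.
have bL : bounded_op (scalar_op c - D) by apply: boundedB => //; exact: bounded_scalar.
have c1 : 0 <= opnorm (scalar_op c - D) < c by rewrite opnorm_ge0.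
have sF := weighted_series_op H_hilbert c0 a_le c1 (fun j => bounded_iter j bL)
  (fun j => iter_bound j bL (lexx _)).
apply: (sums_to_adjoint H_hilbert sF sF) => j; apply: adjoint_pairZ.
by apply: sa_iter; apply: saB => //; exact: sa_scalar.
Qed.

End Center.

End Analyticity.

Section TaylorExpansion.
Context {R : realType} {H : completeNormedModType R[i]}.
Variable ip : {dot H for (@Num.conj R[i])}.
Hypothesis H_hilbert : induces_norm ip.
Hypothesis H_nontrivial : exists v : H, v != 0.
Variable S : symNormedIdeal H.
Variables (f : R -> R) (alpha beta : R) (nu : {measure set R -> \bar R}).
Hypothesis f_loewner : loewner_representation f alpha beta nu.
Implicit Types (C D X : H -> H).

(** [c - (c - (D + X))] is positive and has a Neumann series. *)
Lemma positive_invertible_near D X (c : R) : positive_invertible ip D ->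
  bounded_op X -> selfadjoint ip X ->
  opnorm (scalar_op c - (D + X)) < c -> positive_invertible ip (D + X).
Proof.
move=> [pD iD] bX sX Lc; have [bD _] := pD.
have bDX : bounded_op (D + X) by exact: boundedD.
have sDX : selfadjoint ip (D + X).
  by apply: saD => //; exact: (positive_selfadjoint pD).
split; last exact: (neumann_invertible H_hilbert bDX Lc).
split=> // x; rewrite ip_rip -Im_ip.
set L := scalar_op c - (D + X) in Lc.
have bL : bounded_op L by apply: boundedB => //; exact: bounded_scalar.
have E : D + X = scalar_op c - L by rewrite /L opprB [RHS]addrC subrK.
have real0 : complex.Im (ip ((D + X) x) x) = 0.
  have := congr1 (@complex.Im R) (etrans (sDX x x) (ipC ip x ((D + X) x))).
  by case: (ip ((D + X) x) x) => u v /=; lra.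
rewrite real0 ler0c E !fctE ripBl ripZl (ripxx H_hilbert) subr_ge0.
apply: (le_trans (ler_norm _)); apply: (le_trans (rip_le H_hilbert _ _)).
by rewrite expr2 mulrA ler_wpM2r ?vnorm_ge0// vnorm_opnorm_le// ltW.
Qed.

Lemma translate_sa C D : positive_invertible ip C -> pos_inv_translates ip S C D ->
  ideal_sa ip S (D - C).
Proof.
move=> [pC _] [[pD _] iX]; split=> //.
by apply: saB; exact: (positive_selfadjoint).
Qed.

(** A center [c] above both norms serves [C] and [D] at once. The ratio
    [||D - C||_S / (b - ||K||)] may exceed one, but only the first remainder is
    needed. *)
Lemma fcalc_translate C D : positive_invertible ip C ->
  pos_inv_translates ip S C D -> ideal_sa ip S (fcalc f D - fcalc f C).
Proof.
move=> hC hD; have hX := translate_sa hC hD; have [pC _] := hC.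
have [[pD _] _] := hD; have [bC _] := pC; have [bD _] := pD.
have C0 := opnorm_ge0 bC; have D0 := opnorm_ge0 bD.
pose c := opnorm C + opnorm D + 1.
have c0 : 0 < c by rewrite ltr_wpDl// addr_ge0.
have [Cc _] : opnorm (scalar_op c - C) < c /\
    opnorm (scalar_op c - C) <= c - spectral_min C.
  by apply: (opnorm_scalar_sub H_hilbert H_nontrivial) => //; rewrite /c; lra.
have [Dc _] : opnorm (scalar_op c - D) < c /\
    opnorm (scalar_op c - D) <= c - spectral_min D.
  by apply: (opnorm_scalar_sub H_hilbert H_nontrivial) => //;
    [case: hD|rewrite /c; lra].
(* above the norm of [c - C] strictly, as [step_bound] needs, and at least the
   norm of [c - D] *)
pose b := Num.max ((opnorm (scalar_op c - C) + c) / 2) (opnorm (scalar_op c - D)).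
have Kb : opnorm (scalar_op c - C) < b by rewrite /b lt_max midf_lt.
have bc : b < c by rewrite /b gt_max Dc midf_lt.
have DE : C + (D - C) = D by rewrite addrC subrK.
have LE : scalar_op c - C - (D - C) = scalar_op c - D.
  by rewrite opprB addrA subrK.
have Lb : opnorm (scalar_op c - C - (D - C)) <= b by rewrite LE /b le_max lexx orbT.
have sC := positive_selfadjoint pC.
have [iZ _] := fcalc_remainder H_hilbert H_nontrivial f_loewner c0 bC sC Kb bc 0 hX Lb.
rewrite big_geq// subr0 DE in iZ; split=> //.
apply: saB; apply: (fcalc_sa H_hilbert H_nontrivial f_loewner c0) => //.
exact: positive_selfadjoint.
Qed.

Lemma shift_norm_le C X (c b : R) : bounded_op C -> ideal_set S X ->
  opnorm (scalar_op c - C) + snorm S X <= b -> opnorm (scalar_op c - C - X) <= b.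
Proof.
move=> bC iX; apply: le_trans.
have bX := ideal_bounded iX.
have bK : bounded_op (scalar_op c - C) by apply: boundedB => //; exact: bounded_scalar.
apply: (le_trans (opnormD bK (boundedN bX))); rewrite opnormN lerD2l.
exact: (opnorm_le_snorm H_hilbert iX).
Qed.

Lemma fcalc_analytic C : positive_invertible ip C ->
  real_analytic ip S (pos_inv_translates ip S C) (fcalc f).
Proof.
move=> hC D hD; have [hDp iDC] := hD; have [pD _] := hDp; have [bD _] := pD.
have sD := positive_selfadjoint pD.
pose c := opnorm D + 1.
have c0 : 0 < c by rewrite ltr_wpDl// opnorm_ge0.
have [Dc _] : opnorm (scalar_op c - D) < c /\
    opnorm (scalar_op c - D) <= c - spectral_min D.
  by apply: (opnorm_scalar_sub H_hilbert H_nontrivial) => //; rewrite /c; lra.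
set K := scalar_op c - D in Dc.
have bK : bounded_op K by apply: boundedB => //; exact: bounded_scalar.
have sK : selfadjoint ip K by apply: saB => //; exact: sa_scalar.
pose b := (opnorm K + c) / 2.
have Kb : opnorm K < b by rewrite midf_lt.
have bc : b < c by rewrite midf_lt.
have room : 0 < b - opnorm K by rewrite subr_gt0.
have a_le := loewner_coef_le c0 f_loewner.
(* half of the available room makes the majorant a geometric series of ratio 1/2 *)
pose r := (b - opnorm K) / 2.
pose kappa := weighted_series_bound (moment nu c 0 + beta) c b.
exists r, (poly_term (loewner_coef beta nu c) K),
  (fun n => kappa * (b - opnorm K)^-1 ^+ n); split.
- by rewrite divr_gt0.
- move=> n n0; exact: (homogeneous_poly_term H_hilbert S c0 a_le bK sK Kb bc).
- by move=> n X n0 [iX _]; exact: (snorm_poly_term H_hilbert c0 a_le bK Kb bc).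
- have -> : (fun n => kappa * (b - opnorm K)^-1 ^+ n * r ^+ n) = geometric kappa (2^-1).
    apply/funext => n; rewrite /geometric /= -mulrA -exprMn /r mulrA mulVf ?mul1r//.
    by rewrite gt_eqF.
  by apply: is_cvg_geometric_series; rewrite ger0_norm ?invr_ge0// invf_lt1// ltr1n.
move=> X hX Xr; have [iX sX] := hX.
have x0 := snorm_ge0 iX.
have bX := ideal_bounded iX.
have rb : r < b - opnorm K by rewrite /r; lra.
have Lb : opnorm (K - X) <= b.
  by apply: shift_norm_le => //; rewrite -/K; lra.
have LE : scalar_op c - (D + X) = K - X by rewrite /K opprD addrA.
have hDX : pos_inv_translates ip S C (D + X).
  split; last by rewrite addrAC; exact: ideal_add.
  apply: (positive_invertible_near (c := c)) => //.
  by rewrite LE; exact: (le_lt_trans Lb bc).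
split=> //.
- have hXD : pos_inv_translates ip S D (D + X).
    by split; [case: hDX|rewrite addrAC subrr add0r].
  exact: fcalc_translate.
rewrite -cvg_shiftS/=.
have q1 : `|snorm S X / (b - opnorm K)| < 1.
  rewrite ger0_norm; last by rewrite divr_ge0// ltW.
  by rewrite ltr_pdivrMr// mul1r (lt_trans Xr).
apply: cvg0_le (cvg_geometric (kappa * (snorm S X / (b - opnorm K))) q1) => N.
have [iZ nZ] := fcalc_remainder H_hilbert H_nontrivial f_loewner c0 bD sD Kb bc N hX Lb.
rewrite snorm_ge0//=; apply: (le_trans nZ).
by rewrite /geometric/= exprS mulrA.
Qed.

(** Here [||c - C|| + ||D - C||_S < c] leaves room for a weight [b < c] with
    [||D - C||_S < b - ||c - C||], so that the remainders tend to zero. *)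
Lemma fcalc_taylor C D : positive_invertible ip C ->
  pos_inv_translates ip S C D -> snorm S (D - C) < spectral_min C ->
  (forall n, (1 <= n)%N ->
     weakly_integrable ip nu `]0, +oo[ (taylor_integrand C n (D - C)) /\
     ideal_sa ip S (taylor_term ip beta nu C n (D - C))) /\
  snorm S (fcalc f C + \sum_(1 <= n < k) taylor_term ip beta nu C n (D - C)
    - fcalc f D) @[k --> \oo] --> (0 : R).
Proof.
move=> hC hD; have hX := translate_sa hC hD; have [pC _] := hC; have [bC _] := pC.
have sC := positive_selfadjoint pC.
have DE : C + (D - C) = D by rewrite addrC subrK.
set X := D - C in hX DE *; move=> Xg; have [iX sX] := hX; have x0 := snorm_ge0 iX.
have [_ nu_fin _] := f_loewner.
pose c := opnorm C + 1.
have c0 : 0 < c by rewrite ltr_wpDl// opnorm_ge0.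
have [Cc Cg] : opnorm (scalar_op c - C) < c /\
    opnorm (scalar_op c - C) <= c - spectral_min C.
  by apply: (opnorm_scalar_sub H_hilbert H_nontrivial) => //; rewrite /c; lra.
set K := scalar_op c - C in Cc Cg.
have bK : bounded_op K by apply: boundedB => //; exact: bounded_scalar.
have sK : selfadjoint ip K by apply: saB => //; exact: sa_scalar.
have Kx : opnorm K + snorm S X < c by lra.
pose b := (opnorm K + snorm S X + c) / 2.
have Kb : opnorm K < b by rewrite /b; lra.
have xb : snorm S X < b - opnorm K by rewrite /b; lra.
have bc : b < c by rewrite midf_lt.
have room : 0 < b - opnorm K by rewrite subr_gt0.
have a_le := loewner_coef_le c0 f_loewner.
have Lb : opnorm (K - X) <= b.
  by apply: shift_norm_le => //; rewrite -/K /b; lra.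
have termE n : (0 < n)%N ->
    taylor_term ip beta nu C n X = poly_term (loewner_coef beta nu c) K n X.
  by move=> n0; exact: (taylor_termE H_hilbert c0 nu_fin bC Kb bc iX beta).
split.
  move=> n n0; split.
    by eexists; exact: (taylor_weak_integral H_hilbert c0 nu_fin bC Kb bc iX n0).
  rewrite termE//.
  have [M [M1 _ _] ME] := homogeneous_poly_term H_hilbert S c0 a_le bK sK Kb bc n0.
  by rewrite ME//; apply: M1.
rewrite -cvg_shiftS/=.
have q1 : `|snorm S X / (b - opnorm K)| < 1.
  rewrite ger0_norm; last by rewrite divr_ge0// ltW.
  by rewrite ltr_pdivrMr// mul1r.
apply: cvg0_le (cvg_geometric (weighted_series_bound (moment nu c 0 + beta) c b *
  (snorm S X / (b - opnorm K))) q1) => N.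
have [iZ nZ] := fcalc_remainder H_hilbert H_nontrivial f_loewner c0 bC sC Kb bc N hX Lb.
rewrite DE in iZ nZ.
have -> : \sum_(1 <= n < N.+1) taylor_term ip beta nu C n X =
    \sum_(1 <= n < N.+1) poly_term (loewner_coef beta nu c) K n X.
  by apply: eq_big_nat => n /andP[n0 _]; exact: termE.
set Z := _ - _ - _ in iZ nZ.
have -> : fcalc f C + \sum_(1 <= n < N.+1) poly_term (loewner_coef beta nu c) K n X
    - fcalc f D = - Z.
  by rewrite /Z 2!opprB addrA [_ + fcalc f C]addrC.
rewrite snormN// snorm_ge0//=; apply: (le_trans nZ).
by rewrite /geometric/= exprS mulrA.
Qed.

End TaylorExpansion.

Theorem theorem4p6 (R : realType) (H : completeNormedModType R[i])
    (ip : {dot H for (@Num.conj R[i])})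
    (H_hilbert : induces_norm ip)
    (H_separable : separable H)
    (H_infinite : infinite_dimensional H)
    (S : symNormedIdeal H)
    (f : R -> R) (alpha beta : R) (nu : {measure set R -> \bar R})
    (f_monotone : operator_monotone ip f)
    (f_loewner : loewner_representation f alpha beta nu)
    (C : H -> H) (C_pos : positive_invertible ip C) :
  [/\ forall D, pos_inv_translates ip S C D ->
        ideal_sa ip S (fcalc f D - fcalc f C),
      real_analytic ip S (pos_inv_translates ip S C) (fcalc f)
    & forall D, pos_inv_translates ip S C D ->
        snorm S (D - C) < spectral_min C ->
        (forall n, (1 <= n)%N ->
           weakly_integrable ip nu `]0, +oo[ (taylor_integrand C n (D - C)) /\
           ideal_sa ip S (taylor_term ip beta nu C n (D - C))) /\
        snorm S (fcalc f C
                 + \sum_(1 <= n < k) taylor_term ip beta nu C n (D - C)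
                 - fcalc f D) @[k --> \oo] --> (0 : R)].
Proof.
have H_nontrivial : exists v : H, v != 0.
  have [v /(_ (fun=> 0)) hv] := H_infinite 0%N (fun=> 0).
  by exists v; apply/eqP; rewrite big_ord0 in hv.
split.
- by move=> D hD; exact: (fcalc_translate H_hilbert H_nontrivial f_loewner C_pos hD).
- exact: (fcalc_analytic H_hilbert H_nontrivial f_loewner C_pos).
- by move=> D hD; exact: (fcalc_taylor H_hilbert H_nontrivial f_loewner C_pos hD).
Qed.
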